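(* Let $G_C$ be a causal graph all of whose edges are bidirected, i.e. $(D_i,D_j)$ is an edge of $G_C$ if and only if $(D_j,D_i)$ is. Then the entanglement summoning task with causal graph $G_C$ is achievable if and only if $G_C$, regarded as an undirected graph (each bidirected edge being replaced by one undirected edge), admits a two-clique partition.
   Context: All Hilbert spaces are finite-dimensional. A causal graph $G_C$ is a finite directed graph without self-loops with vertices $D_1,\dots,D_n$ (''diamonds''); write $D_i\to D_j$ if $(D_i,D_j)$ is an edge. Entanglement summoning task with causal graph $G_C$: Alice pre-shares an arbitrary quantum state among systems $X_1,\dots,X_n$ ($X_i$ held at vertex $i$). Vertex $i$ receives a bit $b_i\in\{0,1\}$, where it is promised that exactly two of the bits equal $1$ (at an arbitrary pair $j^*\neq k^*$ unknown in advance). Alice then acts locally, uses one simultaneous round of quantum communication along the directed edges of $G_C$, and acts locally again. Formally, a protocol consists of a state on $X_1\cdots X_n$; for each $i$ and each $b\in\{0,1\}$ a quantum channel $\mathcal N_i^{b}$ from $X_i$ to a tensor product of systems $Y^{i\to j}$, where $j$ ranges over $j=i$ and all $j$ with $D_i\to D_j$; and for each $i$ and $b$ a quantum channel $\mathcal M_i^{b}$ from the tensor product of the systems $Y^{j\to i}$ ($j=i$ or $D_j\to D_i$) to an output system $A_i$. The task is achievable if there is a protocol such that for every pair $j^*\ne k^*$, when $b_{j^*}=b_{k^*}=1$ and all other bits are $0$, the resulting state of $A_{j^*}A_{k^*}$ is exactly a fixed maximally entangled state $|\Psi^+\rangle=\frac1{\sqrt d}\sum_{m}|m\rangle|m\rangle$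 (with $d\ge 2$ fixed). A clique of an undirected graph is a set of vertices that are pairwise adjacent. An undirected graph $(V,E)$ has a two-clique partition if $V=K_1\cup K_2$ with $K_1\cap K_2=\emptyset$ and each of $K_1,K_2$ a clique (one of them may be empty). *)

(* Defs.v *)
From HB Require Import structures.
From mathcomp Require Import all_boot all_order all_algebra.
From mathcomp Require Import reals complex.

Set Implicit Arguments.
Unset Strict Implicit.
Unset Printing Implicit Defensive.

Import Order.TTheory GRing.Theory Num.Theory.
Local Open Scope ring_scope.

(* A finite-dimensional Hilbert space is given by a finite type T labelling an
   orthonormal basis.  Matrices over a finite type are only available through
   its enumeration; [entry] and [mkop] pass between the two presentations. *)
Notation op R T := 'M[R[i]]_(#|{: T}|).
Notation ket R T := 'cV[R[i]]_(#|{: T}|).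

Section Operators.
Variable R : realType.

Definition entry (T : finType) (rho : op R T) (x y : T) : R[i] :=
  rho (enum_rank x) (enum_rank y).

Definition mkop (T : finType) (f : T -> T -> R[i]) : op R T :=
  \matrix_(i, j) f (enum_val i) (enum_val j).

Definition mkket (T : finType) (f : T -> R[i]) : ket R T :=
  \col_i f (enum_val i).

Definition adjoint (m n : nat) (A : 'M[R[i]]_(m, n)) : 'M[R[i]]_(n, m) :=
  map_mx Num.conj A^T.

Definition proj_ket (T : finType) (psi : ket R T) : op R T :=
  psi *m adjoint psi.

Definition basis_unit (T : finType) (x y : T) : op R T :=
  delta_mx (enum_rank x) (enum_rank y).

(* In R[i], [0 <= z] says that z is real and nonnegative, so a positive
   semidefinite operator is automatically Hermitian. *)
Definition psd (T : finType) (rho : op R T) : Prop :=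
  forall v : ket R T, 0 <= (adjoint v *m rho *m v) 0 0.

Definition density (T : finType) (rho : op R T) : Prop :=
  psd rho /\ \tr rho = 1.

(* Phi (x) id_S: Phi acts on each of the #|S| x #|S| blocks of rho. *)
Definition ampliation (T U S : finType) (Phi : op R T -> op R U)
    (rho : op R (T * S)%type) : op R (U * S)%type :=
  mkop (fun p q : U * S =>
    entry (Phi (mkop (fun x y : T => entry rho (x, p.2) (y, q.2)))) p.1 q.1).

Definition completely_positive (T U : finType) (Phi : op R T -> op R U) :
    Prop :=
  forall (S : finType) (rho : op R (T * S)%type),
    psd rho -> psd (ampliation Phi rho).

Definition trace_preserving (T U : finType) (Phi : op R T -> op R U) : Prop :=
  forall rho : op R T, \tr (Phi rho) = \tr rho.

Definition quantum_channel (T U : finType) (Phi : {linear op R T -> op R U}) :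
    Prop :=
  completely_positive Phi /\ trace_preserving Phi.

End Operators.

(* The tensor product of a finite family of spaces: its basis consists of the
   families of basis labels. *)
Definition tensor (I : finType) (T : I -> finType) : finType :=
  {dffun forall i : I, T i}.

Section Tensor.
Variable R : realType.

(* The tensor product of linear maps Phi_i, obtained by expanding rho over the
   operators (x)_i |x_i><x'_i|. *)
Definition tensor_map (I : finType) (T U : I -> finType)
    (Phi : forall i, op R (T i) -> op R (U i))
    (rho : op R (tensor T)) : op R (tensor U) :=
  mkop (fun y y' : tensor U =>
    \sum_(x : tensor T) \sum_(x' : tensor T)
      entry rho x x' *
      \prod_(i : I) entry (Phi i (basis_unit R (x i) (x' i))) (y i) (y' i)).

(* Partial trace of rho over all factors other than j and k. *)
Definition marginal2 (I A : finType) (j k : I)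
    (rho : op R (tensor (fun _ : I => A))) : op R (A * A)%type :=
  mkop (fun p q : A * A =>
    \sum_(x : tensor (fun _ : I => A) | (x j, x k) == p)
    \sum_(x' : tensor (fun _ : I => A) |
            ((x' j, x' k) == q) &&
            [forall i, (i != j) && (i != k) ==> (x' i == x i)])
      entry rho x x').

Definition max_entangled_ket (d : nat) : ket R ('I_d * 'I_d)%type :=
  mkket (fun p : 'I_d * 'I_d =>
    (sqrtC (d%:R : R[i]))^-1 * (p.1 == p.2)%:R).

End Tensor.

Section Summoning.
Variables (n : nat) (E : rel 'I_n).

(* Each vertex may also keep a system to itself during the communication
   round. *)
Definition link (i j : 'I_n) : bool := (i == j) || E i j.

Definition sent (Y : 'I_n -> 'I_n -> finType) (i : 'I_n) : finType :=
  tensor (fun j : {j : 'I_n | link i j} => Y i (val j)).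

Definition received (Y : 'I_n -> 'I_n -> finType) (i : 'I_n) : finType :=
  tensor (fun j : {j : 'I_n | link j i} => Y (val j) i).

(* The systems Y^{i->j} grouped by recipient are the same systems as those
   grouped by sender; [by_sender] is the resulting relabelling of the basis. *)
Definition by_sender (Y : 'I_n -> 'I_n -> finType)
    (z : tensor (received Y)) : tensor (sent Y) :=
  [ffun i : 'I_n =>
    ([ffun j : {j : 'I_n | link i j} =>
       z (val j) (exist (fun k => link k (val j)) i (valP j))] : sent Y i)].

Definition communicate (R : realType) (Y : 'I_n -> 'I_n -> finType)
    (rho : op R (tensor (sent Y))) : op R (tensor (received Y)) :=
  mkop (fun z z' : tensor (received Y) =>
    entry rho (by_sender z) (by_sender z')).

(* The output systems are all C^d, since the outputs at a called pair are
   required to be in a fixed state of C^d (x) C^d. *)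
Record protocol (R : realType) (d : nat) := Protocol {
  resource : 'I_n -> finType;
  message : 'I_n -> 'I_n -> finType;
  shared_state : op R (tensor resource);
  first_map : forall i : 'I_n, bool ->
    {linear op R (resource i) -> op R (sent message i)};
  second_map : forall i : 'I_n, bool ->
    {linear op R (received message i) -> op R 'I_d};
  shared_stateP : density shared_state;
  first_mapP : forall i b, quantum_channel (first_map i b);
  second_mapP : forall i b, quantum_channel (second_map i b)
}.

Definition final_state (R : realType) (d : nat) (P : protocol R d)
    (b : 'I_n -> bool) : op R (tensor (fun _ : 'I_n => 'I_d)) :=
  tensor_map (fun i => second_map P i (b i))
    (communicate (tensor_map (fun i => first_map P i (b i)) (shared_state P))).

Definition calls (j k : 'I_n) : 'I_n -> bool :=
  fun i => (i == j) || (i == k).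

Definition summoning_achievable (R : realType) (d : nat) : Prop :=
  exists P : protocol R d, forall j k : 'I_n, j != k ->
    marginal2 j k (final_state P (calls j k))
    = proj_ket (max_entangled_ket R d).

Definition clique (K : {set 'I_n}) : Prop :=
  {in K &, forall u v : 'I_n, u != v -> E u v}.

Definition two_clique_partition : Prop :=
  exists K1 K2 : {set 'I_n},
    [/\ K1 :|: K2 = [set: 'I_n], K1 :&: K2 = set0, clique K1 & clique K2].

End Summoning.

(* Main.v *)
(* Necessity.  Work in the Heisenberg picture.  Let J be the antisymmetric
   matrix |0><1| - |1><0|.  Dilate all the uncalled first maps to isometries; a
   called vertex v then defines a vector D_v in the dilated space: apply v's
   called first map and second map, apply J to the output, and undo everything
   down to the dilated space.  If v and k are not adjacent, their operations
   touch disjoint systems, so <D_v, D_k> is the expectation of J^* (x) J in the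
   state at the called pair, which is - c for some c > 0, while the
   Kadison-Schwarz inequality gives |D_v|^2 <= c.  Hence D_k = - D_v <> 0
   whenever v and k are not adjacent, so the complement of the graph is
   bipartite.

   Sufficiency.  Share a GHZ state among all vertices, and another one within
   each clique.  An uncalled vertex x-measures its share with a random-sign
   measurement (project on sum_x (-1)^(s x) |x> for a uniform s) and broadcasts
   s.  A called vertex with no called clique mate outputs its global share after
   correcting the signs announced in its clique; two called clique mates learn
   of each other and output their clique shares, the first of them correcting
   the signs. *)
Require Import Defs.
From mathcomp Require Import all_boot all_order all_algebra.
From mathcomp Require Import reals complex.
From HB Require Import structures.
From mathcomp Require Import spectral ring.

Set Implicit Arguments.
Unset Strict Implicit.
Unset Printing Implicit Defensive.

Import Order.TTheory GRing.Theory Num.Theory.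
Local Open Scope ring_scope.

(** * Matrices indexed by a finite basis *)

Lemma sum_enum_rank (V : nmodType) (T : finType) (F : 'I_#|{: T}| -> V) :
  \sum_i F i = \sum_x F (enum_rank x).
Proof. by rewrite (reindex enum_rank) //; apply/onW_bij/enum_rank_bij. Qed.

(** Dependent families are encoded as functions into the tagged union of the [T i], where the
    non-dependent distributivity law applies; [fprod] mediates. *)
Lemma big_distr_tensor (A : comPzSemiRingType) (I : finType) (T : I -> finType)
    (F : forall i, T i -> A) :
  \prod_i \sum_(x : T i) F i x = \sum_(x : tensor T) \prod_i F i (x i).
Proof.
pose P i : {ffun T i -> A} := [ffun x => F i x].
rewrite (reindex (@dffun_of_fprod I T)); last exact/onW_bij/dffun_of_fprod_bij.
transitivity (\sum_(t : fprod T) \prod_i P i (t i)); last first.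
  apply: eq_bigr => t _; apply: eq_bigr => i _.
  by rewrite /P !ffunE.
rewrite big_fprod.
transitivity (\prod_i \sum_(j in tagged_with T i) untag 0 (P i) j); last first.
  exact: bigA_distr_big_dep.
apply: eq_bigr => i _.
rewrite (eq_bigr (P i)); last by move=> x _; rewrite ffunE.
by rewrite (big_tag (fun i => P i) i).
Qed.

Section Operators.
Variable R : realType.
Local Notation C := R[i].

Lemma entry_mkop (T : finType) (f : T -> T -> C) x y : entry (mkop f) x y = f x y.
Proof. by rewrite /entry !mxE !enum_rankK. Qed.

Lemma op_eqP (T : finType) (A B : op R T) :
  (forall x y, entry A x y = entry B x y) -> A = B.
Proof.
by move=> AB; apply/matrixP => k l; rewrite -[k]enum_valK -[l]enum_valK; apply: AB.
Qed.

Lemma entry1 (T : finType) (x y : T) : entry (1%:M : op R T) x y = (x == y)%:R.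
Proof. by rewrite /entry mxE (inj_eq enum_rank_inj). Qed.

Lemma entryM (T : finType) (A B : op R T) x z :
  entry (A *m B) x z = \sum_y entry A x y * entry B y z.
Proof. by rewrite /entry mxE sum_enum_rank. Qed.

Lemma entry_adjoint (T : finType) (A : op R T) x y :
  entry (adjoint A) x y = Num.conj (entry A y x).
Proof. by rewrite /entry !mxE. Qed.

Lemma entryD (T : finType) (A B : op R T) x y :
  entry (A + B) x y = entry A x y + entry B x y.
Proof. by rewrite /entry mxE. Qed.

Lemma entryB (T : finType) (A B : op R T) x y :
  entry (A - B) x y = entry A x y - entry B x y.
Proof. by rewrite /entry !mxE. Qed.

Lemma entryZ (T : finType) a (A : op R T) x y :
  entry (a *: A) x y = a * entry A x y.
Proof. by rewrite /entry !mxE. Qed.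

Lemma entry_sum (T J : finType) (F : J -> op R T) x y :
  entry (\sum_j F j) x y = \sum_j entry (F j) x y.
Proof. by rewrite /entry summxE. Qed.

Lemma entry_unit (T : finType) (x y x' y' : T) :
  entry (basis_unit R x y) x' y' = (x' == x)%:R * (y' == y)%:R.
Proof. by rewrite /entry mxE !(inj_eq enum_rank_inj) -mulnb natrM. Qed.

Lemma mxtrace_entry (T : finType) (A : op R T) : \tr A = \sum_x entry A x x.
Proof. exact: sum_enum_rank. Qed.

Lemma adjointK (m n : nat) (A : 'M[C]_(m, n)) : adjoint (adjoint A) = A.
Proof. by apply/matrixP=> i j; rewrite !mxE conjCK. Qed.

Lemma adjointM (m n p : nat) (A : 'M[C]_(m, n)) (B : 'M[C]_(n, p)) :
  adjoint (A *m B) = adjoint B *m adjoint A.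
Proof. by rewrite /adjoint trmx_mul map_mxM. Qed.

Lemma adjointB (m n : nat) (A B : 'M[C]_(m, n)) :
  adjoint (A - B) = adjoint A - adjoint B.
Proof. by rewrite /adjoint linearB map_mxB. Qed.

Lemma adjointD (m n : nat) (A B : 'M[C]_(m, n)) :
  adjoint (A + B) = adjoint A + adjoint B.
Proof. by rewrite /adjoint linearD map_mxD. Qed.

Lemma adjointZ (m n : nat) a (A : 'M[C]_(m, n)) :
  adjoint (a *: A) = Num.conj a *: adjoint A.
Proof. by apply/matrixP=> i j; rewrite !mxE rmorphM. Qed.

Lemma adjoint1 (n : nat) : adjoint (1%:M : 'M[C]_n) = 1%:M.
Proof. by rewrite /adjoint trmx1 map_mx1. Qed.

Lemma adjoint_sum (m n : nat) (J : finType) (F : J -> 'M[C]_(m, n)) :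
  adjoint (\sum_j F j) = \sum_j adjoint (F j).
Proof.
apply/matrixP=> i j; rewrite !mxE !summxE rmorph_sum.
by apply: eq_bigr => k _; rewrite !mxE.
Qed.

Lemma adjoint_mul_ge0 (m : nat) (v : 'cV[C]_m) : 0 <= (adjoint v *m v) 0 0.
Proof. by rewrite mxE sumr_ge0 // => i _; rewrite !mxE mulrC -normCK exprn_ge0. Qed.

Lemma adjoint_mul_eq0 (m : nat) (v : 'cV[C]_m) : (adjoint v *m v) 0 0 = 0 -> v = 0.
Proof.
rewrite mxE => /eqP; rewrite psumr_eq0; last first.
  by move=> i _; rewrite !mxE mulrC -normCK exprn_ge0.
move=> /allP h; apply/matrixP => i j; rewrite ord1 [RHS]mxE.
have /implyP/(_ isT) := h i (mem_index_enum i).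
by rewrite !mxE mulrC -normCK expf_eq0 /= normr_eq0 => /eqP.
Qed.

Lemma adjoint_mulD (m : nat) (u v : 'cV[C]_m) :
  (adjoint (u + v) *m (u + v)) 0 0 =
  ((adjoint u *m u) 0 0 + (adjoint u *m v) 0 0) + ((adjoint v *m u) 0 0 + (adjoint v *m v) 0 0).
Proof.
have addE (A B : 'M[C]_1) : (A + B) 0 0 = A 0 0 + B 0 0 by rewrite mxE.
by rewrite adjointD mulmxDl !mulmxDr !addE.
Qed.

Lemma psdP (T : finType) (rho : op R T) : psd rho <->
  forall h : T -> C, 0 <= \sum_x \sum_x' Num.conj (h x) * entry rho x x' * h x'.
Proof.
have E (v : ket R T) : (adjoint v *m rho *m v) 0 0 =
  \sum_x \sum_x' Num.conj (v (enum_rank x) 0) * entry rho x x' * v (enum_rank x') 0.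
  rewrite exchange_big mxE sum_enum_rank; apply: eq_bigr => x _.
  rewrite mxE sum_enum_rank mulr_suml; apply: eq_bigr => y _.
  by rewrite !mxE.
split=> h v; last by rewrite E; apply: (h (fun x => v (enum_rank x) 0)).
have := h (mkket v); rewrite E; congr (0 <= _).
by do 2![apply: eq_bigr => ? _]; rewrite !mxE !enum_rankK.
Qed.

Lemma psd_adjoint_mul (T : finType) (m : nat) (B : 'M[C]_(m, #|{: T}|)) :
  @psd R T (adjoint B *m B).
Proof.
move=> v; rewrite mulmxA -mulmxA -adjointM; exact: adjoint_mul_ge0.
Qed.

Lemma psd_sum (T J : finType) (F : J -> op R T) :
  (forall j, psd (F j)) -> psd (\sum_j F j).
Proof.
move=> F0 v; rewrite mulmx_sumr mulmx_suml summxE.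
by apply: sumr_ge0 => j _; apply: F0.
Qed.

(** Complex polarization: vanishing at [u + v] makes [s] antisymmetric; the same with ['i *: v] for
    [v] makes it symmetric as well. *)
Lemma form_eq0 (m : nat) (N : 'M[C]_m) :
  (forall v : 'cV[C]_m, (adjoint v *m N *m v) 0 0 = 0) -> N = 0.
Proof.
move=> N0.
pose s (u v : 'cV[C]_m) : C := (adjoint u *m N *m v) 0 0.
have sD (u v : 'cV[C]_m) : s u v + s v u = 0.
  have addE (A B : 'M[C]_1) : (A + B) 0 0 = A 0 0 + B 0 0 by rewrite mxE.
  have := N0 (u + v); rewrite adjointD !mulmxDl !mulmxDr !addE !N0.
  by rewrite add0r addr0.
have sZ (u v : 'cV[C]_m) a b : s (a *: u) (b *: v) = Num.conj a * b * s u v.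
  by rewrite /s adjointZ -!scalemxAl -scalemxAr scalerA mxE.
have s0 (u v : 'cV[C]_m) : s u v = 0.
  have := sD (1 *: u) ('i *: v); rewrite !sZ rmorph1 !mul1r mulr1 conjCi.
  have -> : s v u = - s u v by apply/eqP; rewrite -addr_eq0 addrC sD.
  rewrite mulrNN -mulrDl -mulr2n => /eqP; rewrite mulf_eq0 mulrn_eq0 /=.
  by rewrite (negPf (neq0Ci _)) => /eqP.
apply/matrixP => i j; rewrite mxE -(s0 (delta_mx i 0) (delta_mx j 0)) /s.
rewrite /adjoint trmx_delta map_delta_mx -rowE -colE !mxE.
by [].
Qed.

(* Polarization: a form whose diagonal is real is Hermitian. *)
Lemma psd_adjoint (T : finType) (rho : op R T) : psd rho -> adjoint rho = rho.
Proof.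
move=> rho0; apply/eqP; rewrite -subr_eq0; apply/eqP; apply: form_eq0 => v.
rewrite mulmxBr mulmxBl mxE [X in _ + X]mxE; apply/eqP; rewrite subr_eq0.
have -> : adjoint v *m adjoint rho *m v = adjoint (adjoint v *m rho *m v).
  by rewrite !adjointM adjointK mulmxA.
by rewrite [X in X == _]mxE mxE; apply/eqP/CrealP/ger0_real.
Qed.

(** Spectral theorem: each eigenvalue is the value of the form at a column of [adjoint P], hence has
    a real square root, and the factor is sqrt(D) P. *)
Lemma psd_gram (T : finType) (rho : op R T) :
  psd rho -> exists B : op R T, rho = adjoint B *m B.
Proof.
move=> rho0.
have rhoN : rho \is normalmx by apply/normalmxP; rewrite -/(adjoint rho) psd_adjoint.
have := orthomx_spectralP rhoN; set P := spectralmx rho; set D := spectral_diag rho.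
have PU : P \is unitarymx := spectral_unitarymx rho.
rewrite invmx_unitary // -/(adjoint P) => rhoE.
have PP : P *m adjoint P = 1%:M by apply/unitarymxP.
have D0 i : 0 <= D 0 i.
  have := rho0 (adjoint P *m delta_mx i 0).
  rewrite adjointM adjointK {1}rhoE !mulmxA -(mulmxA _ P) PP mulmx1.
  rewrite -(mulmxA _ P) PP mulmx1 /adjoint trmx_delta map_delta_mx.
  by rewrite -rowE -colE !mxE eqxx mulr1n.
exists (diag_mx (map_mx sqrtC D) *m P).
rewrite adjointM mulmxA -(mulmxA _ _ (diag_mx _)).
suff -> : adjoint (diag_mx (map_mx sqrtC D)) *m diag_mx (map_mx sqrtC D) = diag_mx D.
  by [].
rewrite /adjoint tr_diag_mx map_diag_mx mulmx_diag; congr diag_mx.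
apply/rowP => j; rewrite !mxE.
have /geC0_conj conjE : 0 <= sqrtC (D 0 j) by rewrite sqrtC_ge0.
by rewrite [X in X * _]conjE -expr2 sqrtCK.
Qed.

End Operators.

(** * Channels in the Heisenberg picture *)

Section Channels.
Variable R : realType.
Local Notation C := R[i].

(** The Choi matrix of [Phi]; [tensor_map] is a product of these coefficients. *)
Definition choi (T U : finType) (Phi : op R T -> op R U) (x x' : T) (y y' : U) : C :=
  entry (Phi (basis_unit R x x')) y y'.

(* The adjoint of Phi for the trace pairing (Heisenberg picture). *)
Definition heis (T U : finType) (Phi : op R T -> op R U) (A : op R U) : op R T :=
  mkop (fun x' x => \sum_y \sum_y' choi Phi x x' y y' * entry A y' y).

(** Kraus form in the Heisenberg direction; [kraus K 1%:M = 1%:M] says that the [K j] stack to an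
    isometry. *)
Definition kraus (m n : nat) (J : finType) (K : J -> 'M[C]_(m, n)) (A : 'M[C]_m) : 'M[C]_n :=
  \sum_j adjoint (K j) *m A *m K j.

Lemma heis1 (T U : finType) (Phi : op R T -> op R U) :
  trace_preserving Phi -> heis Phi 1%:M = 1%:M.
Proof.
move=> tp; apply: op_eqP => x' x; rewrite entry_mkop entry1.
transitivity (\tr (Phi (basis_unit R x x'))).
  rewrite mxtrace_entry; apply: eq_bigr => y _.
  rewrite (bigD1 y) //= big1 ?addr0; first by rewrite entry1 eqxx mulr1.
  by move=> z /negPf zy; rewrite entry1 zy mulr0.
rewrite tp mxtrace_entry (bigD1 x) //= big1.
  by rewrite addr0 entry_unit eqxx mul1r eq_sym.
by move=> z /negPf zx; rewrite entry_unit zx mul0r.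
Qed.

(** Choi's theorem: the Choi matrix is positive, and the conjugated rows of a Gram factor of it are
    Kraus operators. *)
Lemma cp_heis_kraus (T U : finType) (Phi : op R T -> op R U) :
  completely_positive Phi ->
  exists K : (U * T)%type -> 'M[C]_(#|{: U}|, #|{: T}|), heis Phi =1 kraus K.
Proof.
move=> cp.
(* The unnormalized maximally entangled operator, whose ampliation is the Choi matrix. *)
pose Omega : op R (T * T)%type := mkop (fun p q => (p.1 == p.2)%:R * (q.1 == q.2)%:R).
have Omega0 : psd Omega.
  apply/psdP => h; pose s := \sum_(p : T * T) (p.1 == p.2)%:R * h p.
  have -> : \sum_x \sum_x' Num.conj (h x) * entry Omega x x' * h x' = Num.conj s * s.
    rewrite /s rmorph_sum mulr_suml; apply: eq_bigr => p _.
    rewrite mulr_sumr; apply: eq_bigr => q _.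
    by rewrite entry_mkop rmorphM /= conjC_nat !mulrA [Num.conj _ * _]mulrC.
  by rewrite mulrC -normCK exprn_ge0.
have [B BE] := psd_gram (cp _ _ Omega0).
have choiE x x' y y' : choi Phi x x' y y' =
    \sum_e Num.conj (entry B e (y, x)) * entry B e (y', x').
  transitivity (entry (ampliation Phi Omega) (y, x) (y', x')).
    rewrite entry_mkop /= /choi; congr (entry (Phi _) _ _).
    by apply: op_eqP => u v; rewrite entry_unit entry_mkop entry_mkop.
  by rewrite BE entryM; apply: eq_bigr => e _; rewrite entry_adjoint.
exists (fun e => \matrix_(i, j) Num.conj (entry B e (enum_val i, enum_val j))).
move=> A; apply: op_eqP => x' x; rewrite entry_mkop entry_sum.
transitivity (\sum_y \sum_y' \sum_e Num.conj (entry B e (y, x)) * entry B e (y', x') * entry A y' y).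
  by apply: eq_bigr => y _; apply: eq_bigr => y' _; rewrite choiE mulr_suml.
under eq_bigr do rewrite exchange_big.
rewrite exchange_big; apply: eq_bigr => e _; rewrite /entry mxE sum_enum_rank.
apply: eq_bigr => y _; rewrite mxE sum_enum_rank mulr_suml.
apply: eq_bigr => y' _; rewrite !mxE !enum_rankK conjCK /entry.
by rewrite mulrC mulrA mulrC mulrA mulrC !mulrA mulrAC.
Qed.

Section KadisonSchwarz.
Variables (m n : nat) (J : finType) (K : J -> 'M[C]_(m, n)).

Lemma adjoint_kraus A : adjoint (kraus K A) = kraus K (adjoint A).
Proof.
by rewrite adjoint_sum; apply: eq_bigr => j _; rewrite !adjointM adjointK mulmxA.
Qed.

(* The defect in the Kadison-Schwarz inequality is a Gram matrix: the vectors
   are the components of sK orthogonal to the range of the isometry K. *)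
Lemma kraus_defect s t : kraus K 1%:M = 1%:M ->
  \sum_j adjoint (s *m K j - K j *m kraus K s) *m (t *m K j - K j *m kraus K t)
  = kraus K (adjoint s *m t) - adjoint (kraus K s) *m kraus K t.
Proof.
move=> K1.
(* The four terms of the expanded product. Summed over [j], each of [b], [c], [e] gives the same
   product of two [kraus] values, so [c] and [e] cancel. *)
pose a j := adjoint (K j) *m (adjoint s *m t) *m K j.
pose b j := adjoint (K j) *m adjoint s *m K j *m kraus K t.
pose c j := kraus K (adjoint s) *m (adjoint (K j) *m t *m K j).
pose e j := kraus K (adjoint s) *m (adjoint (K j) *m 1%:M *m K j) *m kraus K t.
transitivity (\sum_j (a j - b j - c j + e j)).
  apply: eq_bigr => j _; rewrite /a /b /c /e.
  rewrite adjointB !adjointM adjoint_kraus mulmxBl !mulmxBr mulmx1 !mulmxA.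
  by rewrite opprB addrA addrAC.
rewrite big_split !sumrB /= -mulmx_suml -mulmx_sumr -mulmx_suml -mulmx_sumr.
rewrite -/(kraus K (adjoint s)) -/(kraus K t) -/(kraus K 1%:M) K1 mulmx1.
by rewrite subrK adjoint_kraus.
Qed.

End KadisonSchwarz.
End Channels.

(** * Expectation values of a protocol *)

Section Pairing.
Variable R : realType.
Local Notation C := R[i].

Lemma prod_nat_bool (I : finType) (P b : pred I) :
  \prod_(i | P i) ((b i)%:R : C) = [forall i, P i ==> b i]%:R.
Proof.
case: (boolP [forall i, P i ==> b i]) => [/forallP h | /forallPn [u]].
  by rewrite big1 // => i Pi; have := h i; rewrite Pi /= => ->.
by rewrite negb_imply => /andP[Pu /negPf bu]; rewrite (bigD1 u) //= bu mul0r.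
Qed.

Definition local2 (I A : finType) (j k : I) (f g : op R A) (i : I) : op R A :=
  if i == j then f else if i == k then g else 1%:M.

(** Tracing out a factor amounts to pairing it with the identity. *)
Lemma marginal2_pairing (I A : finType) (j k : I) (rho : op R (tensor (fun _ : I => A)))
    (f g : op R A) : j != k ->
  \sum_p \sum_q entry (marginal2 j k rho) p q * (entry f q.1 p.1 * entry g q.2 p.2)
  = \sum_a \sum_a' entry rho a a' * \prod_i entry (local2 j k f g i) (a' i) (a i).
Proof.
move=> jk; apply/esym.
rewrite (partition_big (fun a : tensor (fun _ : I => A) => (a j, a k)) predT) //=.
apply: eq_bigr => p _; under [RHS]eq_bigr do rewrite entry_mkop mulr_suml.
rewrite [RHS]exchange_big; apply: eq_bigr => a /eqP pE /=.
rewrite (partition_big (fun a : tensor (fun _ : I => A) => (a j, a k)) predT) //=.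
apply: eq_bigr => q _; rewrite [in RHS]big_mkcondr mulr_suml; apply: eq_bigr => a' /eqP qE.
rewrite (bigD1 j) //= (bigD1 k) 1?eq_sym //= /local2 eqxx.
rewrite [k == j]eq_sym (negPf jk) eqxx -pE -qE /=.
rewrite (eq_bigr (fun i => (a' i == a i)%:R)); last first.
  by move=> i /andP[/negPf -> /negPf ->]; rewrite entry1.
rewrite prod_nat_bool !mulrA.
by case: [forall i, _]; rewrite ?mulr1 ?mulr0 ?mul0r.
Qed.

End Pairing.

Section Expectation.
Variables (n : nat) (E : rel 'I_n) (R : realType) (d : nat) (P : protocol E R d).
Local Notation C := R[i].
Local Notation X := (resource P).
Local Notation Y := (message P).
Local Notation rec := (tensor (received E Y)).
Local Notation snt := (tensor (sent E Y)).

(** The inverse relabelling to [by_sender]; cancellation needs irrelevance of the proofs of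
    [link]. *)
Definition by_recipient (y : snt) : rec :=
  [ffun i : 'I_n =>
    ([ffun j : {j : 'I_n | link E j i} =>
       y (val j) (exist (fun k => link E (val j) k) i (valP j))] : received E Y i)].

Lemma by_senderK : cancel (@by_sender n E Y) by_recipient.
Proof.
move=> z; apply/ffunP => i; rewrite ffunE; apply/ffunP => -[j h].
rewrite !ffunE /=.
have e (p q : link E j i) : z i (exist _ j p) = z i (exist _ j q) by rewrite (bool_irrelevance p q).
exact: e.
Qed.

Lemma by_recipientK : cancel by_recipient (@by_sender n E Y).
Proof.
move=> z; apply/ffunP => i; rewrite ffunE; apply/ffunP => -[j h].
rewrite !ffunE /=.
have e (p q : link E i j) : z i (exist _ j p) = z i (exist _ j q) by rewrite (bool_irrelevance p q).
exact: e.
Qed.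

Local Notation outs := (tensor (fun _ : 'I_n => 'I_d)).

Definition transmitted (b : 'I_n -> bool) : op R rec :=
  communicate (tensor_map (fun i => first_map P i (b i)) (shared_state P)).

(** The trace of the transmitted state against the operator with entries [w]. Keeping [w] a function
    of labels allows pointwise rewriting. *)
Definition expect (b : 'I_n -> bool) (w : rec -> rec -> C) : C :=
  \sum_(z : rec) \sum_(z' : rec) entry (transmitted b) z z' * w z' z.

Definition state_form (g : forall i, op R (X i)) : C :=
  \sum_(x : tensor X) \sum_(x' : tensor X)
    entry (shared_state P) x x' * \prod_i entry (g i) (x' i) (x i).

(** Each second map acts at one vertex, so a product observable on the outputs pulls back to a
    product over recipients. *)
Lemma final_pairing b (O : 'I_n -> op R 'I_d) :
  \sum_(a : outs) \sum_(a' : outs)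
    entry (final_state P b) a a' * \prod_i entry (O i) (a' i) (a i)
  = expect b (fun z' z => \prod_i entry (heis (second_map P i (b i)) (O i)) (z' i) (z i)).
Proof.
transitivity (\sum_(a : outs) \sum_(a' : outs) \sum_z \sum_z'
    entry (transmitted b) z z' *
    \prod_i (choi (second_map P i (b i)) (z i) (z' i) (a i) (a' i) * entry (O i) (a' i) (a i))).
  apply: eq_bigr => a _; apply: eq_bigr => a' _.
  rewrite entry_mkop mulr_suml; apply: eq_bigr => z _.
  rewrite mulr_suml; apply: eq_bigr => z' _.
  by rewrite -mulrA -big_split.
under eq_bigr do rewrite exchange_big.
rewrite exchange_big; apply: eq_bigr => z _ /=.
under eq_bigr do rewrite exchange_big.
rewrite exchange_big; apply: eq_bigr => z' _ /=.
under eq_bigr do rewrite -mulr_sumr.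
rewrite -mulr_sumr; congr (_ * _).
under [RHS]eq_bigr do rewrite entry_mkop.
rewrite (big_distr_tensor (fun i o => \sum_o' _)); apply: eq_bigr => a _.
by rewrite (big_distr_tensor (fun i o' => _)).
Qed.

(** Pulling back through the first maps requires products over senders, so the operator is given as
    a combination of such products. *)
Lemma expect_prod b (J : finType) (c : J -> C) (s : J -> forall i, op R (sent E Y i)) :
  expect b (fun z' z => \sum_p c p * \prod_i entry (s p i) (by_sender z' i) (by_sender z i))
  = \sum_p c p * state_form (fun i => heis (first_map P i (b i)) (s p i)).
Proof.
pose F (x x' : tensor X) (y y' : snt) p := c p * (entry (shared_state P) x x' *
  \prod_i (choi (first_map P i (b i)) (x i) (x' i) (y i) (y' i) * entry (s p i) (y' i) (y i))).
transitivity (\sum_y \sum_y' \sum_x \sum_x' \sum_p F x x' y y' p).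
  rewrite /expect (reindex (by_recipient)); last first.
    by exists (@by_sender n E Y) => ? _; rewrite ?by_recipientK ?by_senderK.
  apply: eq_bigr => y _.
  rewrite (reindex (by_recipient)); last first.
    by exists (@by_sender n E Y) => ? _; rewrite ?by_recipientK ?by_senderK.
  apply: eq_bigr => y' _; rewrite entry_mkop entry_mkop !by_recipientK.
  rewrite mulr_suml; apply: eq_bigr => x _.
  rewrite mulr_suml; apply: eq_bigr => x' _.
  rewrite mulr_sumr; apply: eq_bigr => p _.
  by rewrite /F big_split mulrCA !mulrA.
transitivity (\sum_p \sum_x \sum_x' \sum_y \sum_y' F x x' y y' p).
  under eq_bigr do rewrite exchange_big /=.
  rewrite exchange_big /=.
  under eq_bigr do under eq_bigr do rewrite exchange_big /=.
  under eq_bigr do rewrite exchange_big /=.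
  under eq_bigr do under eq_bigr do under eq_bigr do rewrite exchange_big /=.
  under eq_bigr do under eq_bigr do rewrite exchange_big /=.
  under eq_bigr do rewrite exchange_big /=.
  by rewrite exchange_big.
apply: eq_bigr => p _; rewrite mulr_sumr; apply: eq_bigr => x _.
rewrite mulr_sumr; apply: eq_bigr => x' _; rewrite /F.
rewrite [RHS]mulrA.
transitivity (\sum_y (c p * entry (shared_state P) x x' * \sum_y' \prod_i
    (choi (first_map P i (b i)) (x i) (x' i) ((y : snt) i) ((y' : snt) i) *
     entry (s p i) (y' i) (y i)))).
  apply: eq_bigr => y _; rewrite mulr_sumr.
  by apply: eq_bigr => y' _; rewrite mulrA.
rewrite -mulr_sumr; congr (_ * _).
under [RHS]eq_bigr do rewrite entry_mkop.
rewrite (big_distr_tensor (fun i o => \sum_o' _)); apply: eq_bigr => a _.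
by rewrite (big_distr_tensor (fun i o' => _)).
Qed.

End Expectation.

(** * Operators at one recipient as combinations of products over senders *)

Section Slots.
Variables (n : nat) (E : rel 'I_n) (R : realType) (d : nat) (P : protocol E R d).
Local Notation C := R[i].
Local Notation Y := (message P).
Local Notation rec := (tensor (received E Y)).

(** Both coordinates need a proof of [link E u v], hence the match; without a link the condition is
    vacuous. *)
Definition slot (u v : 'I_n) (z : received E Y v) (y : sent E Y u) : bool :=
  match decP (@idP (link E u v)) with
  | left h => y (exist _ v h) == z (exist _ u h)
  | right _ => true
  end.

Definition agree_off (v u : 'I_n) (y' y : sent E Y u) : bool :=
  [forall j : {j : 'I_n | link E u j}, (val j != v) ==> (y' j == y j)].

(* |z'><z| on the message from u to v, if there is one, and the identity on
   the other messages of u. *)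
Definition slot_unit (v : 'I_n) (p : received E Y v * received E Y v) (u : 'I_n) :
    op R (sent E Y u) :=
  mkop (fun y' y => (slot p.1 y' && slot p.2 y && agree_off v y' y)%:R).

(** [f] at [v], tensored with the identity on what all other vertices receive. *)
Definition on_recipient (v : 'I_n) (f : op R (received E Y v)) (z' z : rec) : C :=
  entry f (z' v) (z v) * [forall i, (i != v) ==> (z' i == z i)]%:R.

Lemma slot_by_sender v (z0 : received E Y v) (z : rec) :
  [forall u, slot z0 (by_sender z u)] = (z0 == z v).
Proof.
apply/forallP/eqP => [h | -> u].
  apply/ffunP => -[u uv]; have := h u; rewrite /slot.
  case: decP => [uv' | /(_ uv)] //.
  rewrite !ffunE /= => /eqP zE; rewrite (bool_irrelevance uv uv') -zE.
  have e (p q : link E u v) : z v (exist _ u p) = z v (exist _ u q) by rewrite (bool_irrelevance p q).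
  exact: e.
rewrite /slot; case: decP => // uv; rewrite !ffunE /=; apply/eqP.
have e (p q : link E u v) : z v (exist _ u p) = z v (exist _ u q) by rewrite (bool_irrelevance p q).
exact: e.
Qed.

Lemma agree_by_sender v (z' z : rec) :
  [forall u, agree_off v (by_sender z' u) (by_sender z u)]
  = [forall i, (i != v) ==> (z' i == z i)].
Proof.
apply/forallP/forallP => h u.
  apply/implyP => uv; apply/eqP/ffunP => -[j ju].
  have /forallP/(_ (exist _ u ju)) := h j; rewrite /= uv !ffunE /= => /eqP.
  have e (z1 : rec) (p q : link E j u) : z1 u (exist _ j p) = z1 u (exist _ j q) by rewrite (bool_irrelevance p q).
  by rewrite (e z' _ ju) (e z _ ju).
apply/forallP => -[j uj]; apply/implyP => /= jv.
by have := h j; rewrite jv /= !ffunE /= => /eqP ->.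
Qed.

(** Locality: an operation at [v] does not touch the messages of a vertex that sends nothing to [v].
    Nonadjacency enters the argument here. *)
Lemma slot_unit1 v (p : received E Y v * received E Y v) u : ~~ link E u v -> slot_unit p u = 1%:M :> op R (sent E Y u).
Proof.
move=> uv; apply: op_eqP => y' y; rewrite entry_mkop entry1 /slot.
case: decP => [uv' | _]; first by rewrite uv' in uv.
congr (_%:R); rewrite /= ; congr nat_of_bool.
apply/forallP/eqP => [h | -> j]; last by rewrite eqxx implybT.
apply/ffunP => j; apply/eqP.
have jv : val j != v by apply: contra uv => /eqP <-; apply: valP.
by have := h j; rewrite jv.
Qed.

(** Expand [f] over matrix units; a matrix unit on everything [v] receives factors over the
    senders. *)
Lemma on_recipient_slots v (f : op R (received E Y v)) (z' z : rec) :
  on_recipient f z' z = \sum_(p : received E Y v * received E Y v) entry f p.1 p.2 *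
    \prod_u entry (slot_unit p u) (by_sender z' u) (by_sender z u).
Proof.
have pE (p : received E Y v * received E Y v) : \prod_u entry (slot_unit p u) (by_sender z' u) (by_sender z u) =
  ((p == (z' v, z v)) && [forall i, (i != v) ==> (z' i == z i)])%:R :> C.
  under eq_bigr do rewrite entry_mkop.
  rewrite prod_nat_bool; congr (nat_of_bool _)%:R.
  rewrite -agree_by_sender; case: p => p1 p2; rewrite xpair_eqE -!slot_by_sender /=.
  apply/forallP/andP => [h | [/andP[/forallP h1 /forallP h2] /forallP h3] u].
    by split; [apply/andP; split|]; apply/forallP => u; have /andP[/andP[]] := h u.
  by rewrite h1 h2 h3.
under eq_bigr => p _ do rewrite pE.
rewrite (bigD1 (z' v, z v)) //= big1 ?addr0; first by rewrite eqxx.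
by move=> p /negPf ->; rewrite mulr0.
Qed.

Lemma on_recipient_mul v (f g : op R (received E Y v)) (z' z : rec) :
  \sum_z0 Num.conj (on_recipient f z0 z') * on_recipient g z0 z
  = on_recipient (adjoint f *m g) z' z.
Proof.
rewrite /on_recipient entryM mulr_suml.
rewrite (partition_big (fun z0 : rec => z0 v) predT) //=; apply: eq_bigr => u _.
(* The only intermediate label that contributes: [z] with its coordinate at [v] set to [u]. *)
pose z1 : rec := finfun (dfwith z u).
have z1v : z1 v = u by rewrite ffunE dfwith_in.
have z1o i : i != v -> z1 i = z i by move=> iv; rewrite ffunE dfwith_out // eq_sym.
rewrite (bigD1 z1) /= ?z1v // big1 ?addr0.
  have -> : [forall i, (i != v) ==> (z1 i == z' i)] = [forall i, (i != v) ==> (z' i == z i)].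
    by apply: eq_forallb => i; case: (boolP (i != v)) => //= iv; rewrite z1o // eq_sym.
  have -> : [forall i, (i != v) ==> (z1 i == z i)].
    by apply/forallP => i; apply/implyP => /z1o ->.
  by rewrite mulr1 rmorphM /= conjC_nat entry_adjoint mulrAC.
move=> z0 /andP[/eqP z0v z01].
case: (boolP [forall i, (i != v) ==> (z0 i == z i)]) => [/forallP h | _]; last by rewrite !mulr0.
case/eqP: z01; apply/ffunP => i; have := h i.
case: (eqVneq i v) => [-> | iv] /=; first by rewrite z0v z1v.
by move/eqP ->; rewrite z1o.
Qed.

(** Distinct recipients hold distinct tensor factors; the only contributing intermediate label is
    [z] with its coordinate at [k] taken from [z']. *)
Lemma on_recipient_mul2 v k (f : op R (received E Y v)) (g : op R (received E Y k)) (z' z : rec) :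
  v != k ->
  \sum_z0 Num.conj (on_recipient f z0 z') * on_recipient g z0 z
  = entry (adjoint f) (z' v) (z v) * entry g (z' k) (z k)
    * [forall i, (i != v) && (i != k) ==> (z' i == z i)]%:R.
Proof.
move=> vk; pose z1 : rec := finfun (dfwith z (z' k)).
have z1k : z1 k = z' k by rewrite ffunE dfwith_in.
have z1o i : i != k -> z1 i = z i by move=> iv; rewrite ffunE dfwith_out // eq_sym.
rewrite (bigD1 z1) //= big1 ?addr0.
  rewrite /on_recipient z1k (z1o v vk) entry_adjoint rmorphM /= conjC_nat.
  have -> : [forall i, (i != k) ==> (z1 i == z i)].
    by apply/forallP => i; apply/implyP => /z1o ->.
  have -> : [forall i, (i != v) ==> (z1 i == z' i)] =
            [forall i, (i != v) && (i != k) ==> (z' i == z i)].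
    apply: eq_forallb => i; case: (eqVneq i v) => //= _.
    by case: (eqVneq i k) => [-> | ik] /=; rewrite ?z1k ?eqxx // z1o // eq_sym.
  by rewrite mulr1 mulrAC.
move=> z0 z01; rewrite /on_recipient.
case: (boolP [forall i, (i != k) ==> (z0 i == z i)]) => [/forallP h | _]; last by rewrite !mulr0.
case: (boolP [forall i, (i != v) ==> (z0 i == z' i)]) => [/forallP h' | _]; last first.
  by rewrite mulr0 conjC0 mul0r.
case/eqP: z01; apply/ffunP => i; have := h i.
case: (eqVneq i k) => [-> _ | ik /= /eqP ->]; last by rewrite z1o.
by have := h' k; rewrite eq_sym vk z1k => /eqP.
Qed.

End Slots.

(** * The vectors attached to called vertices *)

Section GramVectors.
Variables (n : nat) (E : rel 'I_n) (R : realType) (d : nat) (P : protocol E R d).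
Local Notation C := R[i].
Local Notation X := (resource P).
Local Notation Y := (message P).
Local Notation rec := (tensor (received E Y)).
Local Notation snt := (tensor (sent E Y)).
Variable L : 'I_n -> finType.

(** A combination of product operators; [a p i] is read as a map from [X i] into the messages of [i]
    tensored with an environment [L i]. *)
Definition sum_tensor (J : finType) (c : J -> C)
    (a : J -> forall i, L i -> 'M[C]_(#|{: sent E Y i}|, #|{: X i}|))
    (l : snt * tensor L) (x : tensor X) : C :=
  \sum_p c p * \prod_i a p i (l.2 i) (enum_rank (l.1 i)) (enum_rank (x i)).

(** The trace of rho F^* G, that is, the inner product of [F] and [G] applied to a purification of
    the shared state. It is only semidefinite. *)
Definition inner (F G : snt * tensor L -> tensor X -> C) : C :=
  \sum_l \sum_x \sum_x' entry (shared_state P) x x' * (Num.conj (F l x') * G l x).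

Lemma inner_ge0 F : 0 <= inner F F.
Proof.
apply: sumr_ge0 => l _.
have [/psdP/(_ (fun x => Num.conj (F l x))) h _] := shared_stateP P.
congr (0 <= _): h; do 2![apply: eq_bigr => ? _].
by rewrite conjCK -mulrA mulrCA [F _ _ * _]mulrC.
Qed.

Lemma inner_suml (J : finType) (t : J -> C) F G :
  inner (fun l x => \sum_j t j * F j l x) G = \sum_j Num.conj (t j) * inner (F j) G.
Proof.
rewrite /inner; under [RHS]eq_bigr do rewrite mulr_sumr.
rewrite [RHS]exchange_big; apply: eq_bigr => l _ /=.
under [RHS]eq_bigr do rewrite mulr_sumr.
rewrite [RHS]exchange_big; apply: eq_bigr => x _ /=.
under [RHS]eq_bigr do rewrite mulr_sumr.
rewrite [RHS]exchange_big; apply: eq_bigr => x' _ /=.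
rewrite rmorph_sum mulr_suml mulr_sumr; apply: eq_bigr => j _.
by rewrite rmorphM /= [RHS]mulrCA !mulrA.
Qed.

Lemma inner_sumr (J : finType) (t : J -> C) F G :
  inner G (fun l x => \sum_j t j * F j l x) = \sum_j t j * inner G (F j).
Proof.
rewrite /inner; under [RHS]eq_bigr do rewrite mulr_sumr.
rewrite [RHS]exchange_big; apply: eq_bigr => l _ /=.
under [RHS]eq_bigr do rewrite mulr_sumr.
rewrite [RHS]exchange_big; apply: eq_bigr => x _ /=.
under [RHS]eq_bigr do rewrite mulr_sumr.
rewrite [RHS]exchange_big; apply: eq_bigr => x' _ /=.
by rewrite !mulr_sumr; apply: eq_bigr => j _; rewrite [RHS]mulrCA; congr (_ * _); rewrite mulrCA.
Qed.

Lemma inner_sum_tensor (J J' : finType) (c : J -> C) (c' : J' -> C) a a' :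
  inner (sum_tensor c a) (sum_tensor c' a') =
  \sum_p \sum_q Num.conj (c p) * c' q *
    state_form (P := P) (fun i => \sum_e adjoint (a p i e) *m a' q i e).
Proof.
rewrite inner_suml; apply: eq_bigr => p _.
rewrite inner_sumr mulr_sumr; apply: eq_bigr => q _.
rewrite mulrA; congr (_ * _); rewrite /inner exchange_big; apply: eq_bigr => x _ /=.
rewrite exchange_big; apply: eq_bigr => x' _ /=; rewrite -mulr_sumr; congr (_ * _).
have e i : entry (\sum_e adjoint (a p i e) *m a' q i e) (x' i) (x i) =
   \sum_y \sum_e Num.conj (a p i e (enum_rank y) (enum_rank (x' i)))
                 * a' q i e (enum_rank y) (enum_rank (x i)).
  rewrite exchange_big entry_sum; apply: eq_bigr => e _.
  by rewrite /entry mxE sum_enum_rank; apply: eq_bigr => y _; rewrite !mxE.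
under [RHS]eq_bigr do rewrite e.
rewrite (big_distr_tensor (fun i y => \sum_e _)) /=.
rewrite -(pair_big predT predT (fun y e => Num.conj (\prod_i a p i ((e : tensor L) i)
   (enum_rank ((y : snt) i)) (enum_rank (x' i))) *
   (\prod_i a' q i (e i) (enum_rank (y i)) (enum_rank (x i))))) /=.
apply: eq_bigr => y _; rewrite (big_distr_tensor (fun i e => _)) /=.
by apply: eq_bigr => f _; rewrite rmorph_prod -big_split.
Qed.

(** Multilinearity in the factor at [u]. *)
Lemma state_formD (u : 'I_n) (g h h' : forall i, op R (X i)) :
  g u = h u + h' u -> (forall i, i != u -> g i = h i) ->
  (forall i, i != u -> g i = h' i) ->
  state_form (P := P) g = state_form (P := P) h + state_form (P := P) h'.
Proof.
move=> gu gh gh'; rewrite /state_form -big_split /=; apply: eq_bigr => x _.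
rewrite -big_split /=; apply: eq_bigr => x' _; rewrite -mulrDr.
have gE : \prod_i entry (g i) (x' i) (x i) =
    entry (g u) (x' u) (x u) * \prod_(i | i != u) entry (g i) (x' i) (x i).
  by rewrite (bigD1 u).
have hE : \prod_i entry (h i) (x' i) (x i) =
    entry (h u) (x' u) (x u) * \prod_(i | i != u) entry (g i) (x' i) (x i).
  by rewrite (bigD1 u) //=; congr (_ * _); apply: eq_bigr => i /gh ->.
have hE' : \prod_i entry (h' i) (x' i) (x i) =
    entry (h' u) (x' u) (x u) * \prod_(i | i != u) entry (g i) (x' i) (x i).
  by rewrite (bigD1 u) //=; congr (_ * _); apply: eq_bigr => i /gh' ->.
by rewrite gE hE hE' gu entryD mulrDl.
Qed.

End GramVectors.

(** * Inner products of the dilated vectors as expectations *)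

Section Heisenberg.
Variables (n : nat) (E : rel 'I_n) (R : realType) (d : nat) (P : protocol E R d).
Local Notation C := R[i].
Local Notation X := (resource P).
Local Notation Y := (message P).
Local Notation rec := (tensor (received E Y)).
Local Notation snt := (tensor (sent E Y)).
Local Notation L := (fun i => (sent E Y i * X i)%type : finType).
Variable K : bool -> forall i, L i -> 'M[C]_(#|{: sent E Y i}|, #|{: X i}|).
Hypothesis heisK : forall b i, heis (first_map P i b) =1 kraus (@K b i).

Lemma eq_expect b (w1 w2 : rec -> rec -> C) :
  (forall z' z, w1 z' z = w2 z' z) -> expect (P := P) b w1 = expect (P := P) b w2.
Proof. by move=> w12; do 2![apply: eq_bigr => ? _]; rewrite w12. Qed.

Lemma eq_state_form (g h : forall i, op R (X i)) :
  (forall i, g i = h i) -> state_form (P := P) g = state_form (P := P) h.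
Proof.
move=> gh; do 2![apply: eq_bigr => ? _]; congr (_ * _).
by apply: eq_bigr => i _; rewrite gh.
Qed.

Lemma on_recipient_mul_slots v k (f : op R (received E Y v)) (g : op R (received E Y k))
    (z' z : rec) :
  \sum_z0 Num.conj (on_recipient f z0 z') * on_recipient g z0 z =
  \sum_(r : (received E Y v * received E Y v) * (received E Y k * received E Y k))
    Num.conj (entry f r.1.1 r.1.2) * entry g r.2.1 r.2.2 *
    \prod_i entry (adjoint (slot_unit r.1 i) *m slot_unit r.2 i)
                  (by_sender z' i) (by_sender z i).
Proof.
pose A (r : (received E Y v * received E Y v) * (received E Y k * received E Y k))
    (y0 : snt) := Num.conj (entry f r.1.1 r.1.2) * entry g r.2.1 r.2.2 *
  \prod_i (Num.conj (entry (slot_unit r.1 i) (y0 i) (by_sender z' i)) *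
           entry (slot_unit r.2 i) (y0 i) (by_sender z i)).
transitivity (\sum_r \sum_y0 A r y0); last first.
  apply: eq_bigr => r _; rewrite -mulr_sumr; congr (_ * _).
  rewrite -(big_distr_tensor (fun i y => Num.conj (entry (slot_unit r.1 i) y (by_sender z' i))
     * entry (slot_unit r.2 i) y (by_sender z i))).
  apply: eq_bigr => i _; rewrite entryM; apply: eq_bigr => y _.
  by rewrite entry_adjoint.
rewrite exchange_big [RHS](reindex (@by_sender n E Y)) /=; last first.
  exact/onW_bij/(Bijective (@by_senderK n E R d P) (@by_recipientK n E R d P)).
apply: eq_bigr => z0 _; rewrite !on_recipient_slots rmorph_sum mulr_suml.
rewrite -(pair_big predT predT (fun p q => A (p, q) (by_sender z0))) /=.
apply: eq_bigr => p _; rewrite mulr_sumr; apply: eq_bigr => q _.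
by rewrite /A /= big_split /= rmorphM rmorph_prod /= mulrACA.
Qed.

Lemma expect_on_recipient_mul b v k (f : op R (received E Y v)) (g : op R (received E Y k)) :
  expect (P := P) b (fun z' z => \sum_z0 Num.conj (on_recipient f z0 z') * on_recipient g z0 z) =
  \sum_(p : received E Y v * received E Y v) \sum_(q : received E Y k * received E Y k)
    Num.conj (entry f p.1 p.2) * entry g q.1 q.2 *
    state_form (P := P) (fun i => heis (first_map P i (b i)) (adjoint (slot_unit p i) *m slot_unit q i)).
Proof.
rewrite (eq_expect _ (fun z' z => on_recipient_mul_slots f g z' z)).
by rewrite expect_prod pair_big.
Qed.

(* Only the called vertex v departs from the uncalled behaviour, and its first
   map is undone afterwards, so that vectors for different v live in the same
   space. *)
Definition dilated_unit v (p : received E Y v * received E Y v) i (e : L i) :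
    'M[C]_(#|{: sent E Y i}|, #|{: X i}|) :=
  if i == v then K false e *m heis (first_map P i true) (slot_unit p i)
  else slot_unit p i *m K false e.

Definition dilated_vec v (f : op R (received E Y v)) : snt * tensor L -> tensor X -> C :=
  sum_tensor (P := P) (fun p => entry f p.1 p.2) (@dilated_unit v).

(** At [v], the Kadison-Schwarz defect of the called first map: what is lost when that map is
    undone. *)
Definition defect_unit v (p : received E Y v * received E Y v) i (e : L i) :
    'M[C]_(#|{: sent E Y i}|, #|{: X i}|) :=
  if i == v then slot_unit p i *m K true e - K true e *m heis (first_map P i true) (slot_unit p i)
  else slot_unit p i *m K false e.

Lemma kraus1 b i : kraus (@K b i) 1%:M = 1%:M.
Proof. by rewrite -heisK heis1 //; case: (first_mapP P i b). Qed.

Lemma kraus_sum b i : \sum_e adjoint (K b (e : L i)) *m K b e = 1%:M.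
Proof. by rewrite -[RHS](kraus1 b i); apply: eq_bigr => e _; rewrite mulmx1. Qed.

Lemma kraus_slots b i (s t : op R (sent E Y i)) :
  \sum_e adjoint (s *m K b (e : L i)) *m (t *m K b e) = kraus (@K b i) (adjoint s *m t).
Proof. by apply: eq_bigr => e _; rewrite adjointM !mulmxA. Qed.

(** At [v] the operator coming from [k] is the identity, so the uncalled isometry cancels and the
    called Heisenberg map remains; symmetrically at [k]. Elsewhere both vectors use the uncalled
    maps. The result is the situation where exactly [v] and [k] are called. *)
Lemma inner_dilated v k (f : op R (received E Y v)) (g : op R (received E Y k)) :
  ~~ link E v k -> ~~ link E k v ->
  inner (P := P) (dilated_vec f) (dilated_vec g) =
  expect (P := P) (calls v k) (fun z' z => entry (adjoint f) (z' v) (z v) * entry g (z' k) (z k)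
    * [forall i, (i != v) && (i != k) ==> (z' i == z i)]%:R).
Proof.
move=> nvk nkv; have vk : v != k by apply: contra nvk => /eqP ->; rewrite /link eqxx.
rewrite inner_sum_tensor.
rewrite -(eq_expect _ (fun z' z => on_recipient_mul2 f g z' z vk)).
rewrite expect_on_recipient_mul; apply: eq_bigr => p _; apply: eq_bigr => q _.
congr (_ * _); apply: eq_state_form => i; rewrite /dilated_unit /calls.
case: (eqVneq i v) => [-> | iv] /=.
  rewrite (negPf vk) (slot_unit1 q nvk) mulmx1 !heisK -adjoint_kraus.
  under eq_bigr => e _ do rewrite adjointM mul1mx -mulmxA.
  by rewrite -mulmx_sumr kraus_sum mulmx1.
case: (eqVneq i k) => [-> | ik]; last by rewrite kraus_slots heisK.
rewrite (slot_unit1 p nkv) adjoint1 mul1mx !heisK.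
under eq_bigr => e _ do rewrite mul1mx mulmxA.
by rewrite -mulmx_suml kraus_sum mul1mx.
Qed.

(** The Kadison-Schwarz identity at [v]. As [k] sends nothing to [v], calling [k] changes nothing in
    the factor at [k]. *)
Lemma expect_square_dilated v k (f : op R (received E Y v)) : ~~ link E k v ->
  expect (P := P) (calls v k) (fun z' z => on_recipient (adjoint f *m f) z' z) =
  inner (P := P) (dilated_vec f) (dilated_vec f) +
  inner (P := P) (sum_tensor (fun p => entry f p.1 p.2) (@defect_unit v))
        (sum_tensor (fun p => entry f p.1 p.2) (@defect_unit v)).
Proof.
move=> nkv; have kv : k != v by apply: contra nkv => /eqP ->; rewrite /link eqxx.
rewrite !inner_sum_tensor -(eq_expect _ (fun z' z => on_recipient_mul f f z' z)).
rewrite expect_on_recipient_mul -big_split; apply: eq_bigr => p _.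
rewrite -big_split; apply: eq_bigr => q _ /=; rewrite -mulrDr; congr (_ * _).
have off i : i != v -> heis (first_map P i (calls v k i)) (adjoint (slot_unit p i) *m slot_unit q i)
    = \sum_e adjoint (slot_unit p i *m K false (e : L i)) *m (slot_unit q i *m K false e).
  move=> /negPf iv; rewrite kraus_slots heisK /calls iv /=.
  case: (eqVneq i k) => [-> | //].
  by rewrite !(slot_unit1 _ nkv) adjoint1 mulmx1 !kraus1.
apply: (state_formD (u := v)) => [|i iv|i iv]; rewrite /dilated_unit /defect_unit.
- rewrite !eqxx /calls eqxx /= heisK.
  under eq_bigr => e _ do rewrite adjointM -mulmxA [adjoint (K _ _) *m _]mulmxA.
  rewrite -mulmx_sumr -mulmx_suml kraus_sum mul1mx.
  under [X in _ = _ + X]eq_bigr => e _ do rewrite !heisK.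
  by rewrite kraus_defect ?kraus1 // !heisK addrC subrK.
- by rewrite (negPf iv) off.
- by rewrite (negPf iv) off.
Qed.

Lemma inner_dilated_le v k (f : op R (received E Y v)) : ~~ link E k v ->
  inner (P := P) (dilated_vec f) (dilated_vec f) <=
  expect (P := P) (calls v k) (fun z' z => on_recipient (adjoint f *m f) z' z).
Proof. by move=> nkv; rewrite expect_square_dilated // lerDl inner_ge0. Qed.

(** Apply the square formula to a Gram factor of [f]. *)
Lemma expect_on_recipient_ge0 v k (f : op R (received E Y v)) : ~~ link E k v ->
  psd f -> 0 <= expect (P := P) (calls v k) (fun z' z => on_recipient f z' z).
Proof.
move=> nkv /psd_gram[B ->]; rewrite expect_square_dilated //.
by rewrite addr_ge0 // inner_ge0.
Qed.

End Heisenberg.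

(** * Necessity *)

Section Necessity.
Variables (n : nat) (E : rel 'I_n) (R : realType) (d : nat) (P : protocol E R d).
Local Notation C := R[i].
Local Notation Y := (message P).
Local Notation rec := (tensor (received E Y)).

Lemma entry_max_entangled (p q : 'I_d * 'I_d) :
  entry (proj_ket (max_entangled_ket R d)) p q
  = d%:R^-1 * ((p.1 == p.2)%:R * (q.1 == q.2)%:R).
Proof.
rewrite /entry /proj_ket mxE big_ord1 !mxE !enum_rankK rmorphM /= conjC_nat mulrACA.
congr (_ * _); rewrite -normCK normfV exprVn; congr (_^-1).
by rewrite ger0_norm ?sqrtC_ge0 ?ler0n // sqrtCK.
Qed.

(** The vertices other than [v] and [k] carry the identity, which unital Heisenberg maps
    preserve. *)
Lemma expect_outcomes (b : 'I_n -> bool) (v k : 'I_n) (f g : op R 'I_d) : v != k ->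
  \sum_p \sum_q entry (marginal2 v k (final_state P b)) p q
    * (entry f q.1 p.1 * entry g q.2 p.2) =
  expect (P := P) b (fun z' z =>
    entry (heis (second_map P v (b v)) f) (z' v) (z v) *
    entry (heis (second_map P k (b k)) g) (z' k) (z k) *
    [forall i, (i != v) && (i != k) ==> (z' i == z i)]%:R).
Proof.
move=> vk; rewrite marginal2_pairing // final_pairing; apply: eq_expect => z' z.
rewrite (bigD1 v) //= (bigD1 k) 1?eq_sym //= mulrA /local2 !eqxx [k == v]eq_sym (negPf vk).
congr (_ * _); rewrite -prod_nat_bool; apply: eq_bigr => i /andP[/negPf iv /negPf ik].
by rewrite iv ik heis1 ?entry1 //; case: (second_mapP P i (b i)).
Qed.

Hypothesis summons : forall v k : 'I_n, v != k ->
  marginal2 v k (final_state P (calls v k)) = proj_ket (max_entangled_ket R d).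

(** In the maximally entangled state, f (x) g has expectation tr(f^T g) / d. *)
Lemma expect_summoned (v k : 'I_n) (f g : op R 'I_d) : v != k ->
  expect (P := P) (calls v k) (fun z' z =>
    entry (heis (second_map P v true) f) (z' v) (z v) *
    entry (heis (second_map P k true) g) (z' k) (z k) *
    [forall i, (i != v) && (i != k) ==> (z' i == z i)]%:R) =
  d%:R^-1 * \sum_m \sum_m' entry f m' m * entry g m' m.
Proof.
move=> vk.
have := expect_outcomes (calls v k) f g vk.
rewrite {3 4}/calls !eqxx orbT /= => <-; rewrite summons // mulr_sumr.
transitivity (\sum_a \sum_b \sum_q entry (proj_ket (max_entangled_ket R d)) (a, b) q
    * (entry f q.1 a * entry g q.2 b)).
  by rewrite [RHS]pair_bigA; apply: eq_bigr => -[].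
apply: eq_bigr => m _; rewrite (bigD1 m) //= [X in _ + X]big1 ?addr0; last first.
  move=> m' /negPf mm'; rewrite big1 // => q _.
  by rewrite entry_max_entangled /= eq_sym mm' mul0r mulr0 mul0r.
rewrite mulr_sumr.
transitivity (\sum_a \sum_b entry (proj_ket (max_entangled_ket R d)) (m, m) (a, b)
    * (entry f a m * entry g b m)).
  by rewrite [RHS]pair_bigA; apply: eq_bigr => -[].
apply: eq_bigr => m' _; rewrite (bigD1 m') //= big1 ?addr0; last first.
  move=> m2 /negPf mm2; rewrite entry_max_entangled /= [m' == _]eq_sym mm2.
  by rewrite mulr0 mulr0 mul0r.
by rewrite entry_max_entangled /= !eqxx !mulr1.
Qed.

Local Notation L := (fun i => (sent E Y i * resource P i)%type : finType).
Variable K : bool -> forall i, L i -> 'M[C]_(#|{: sent E Y i}|, #|{: resource P i}|).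
Hypothesis heisK : forall b i, heis (first_map P i b) =1 kraus (@K b i).

Definition output_vec (J : op R 'I_d) (v : 'I_n) :=
  dilated_vec K (heis (second_map P v true) J).

(** Kadison-Schwarz is used twice, for the first and for the second map of [v]. What remains is J^*
    J at [v] with the identity at [k], whose expectation is known. *)
Lemma inner_output_le (J : op R 'I_d) (v k : 'I_n) : v != k -> ~~ link E k v ->
  inner (P := P) (output_vec J v) (output_vec J v) <=
  d%:R^-1 * \sum_m \sum_m' Num.conj (entry J m' m) * entry J m' m.
Proof.
move=> vk nkv.
pose F (f : op R (received E Y v)) := expect (P := P) (calls v k) (fun z' z => on_recipient f z' z).
have FB f g : F (f - g) = F f - F g.
  rewrite /F /expect -sumrB; apply: eq_bigr => z _; rewrite -sumrB.
  by apply: eq_bigr => z' _; rewrite -mulrBr /on_recipient entryB mulrBl.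
have [W WE] := cp_heis_kraus (proj1 (second_mapP P v true)).
have W1 : kraus W 1%:M = 1%:M by rewrite -WE heis1 //; case: (second_mapP P v true).
have le1 : F (adjoint (heis (second_map P v true) J) *m heis (second_map P v true) J)
    <= F (heis (second_map P v true) (adjoint J *m J)).
  rewrite -subr_ge0 -FB; apply: (expect_on_recipient_ge0 heisK) => //.
  rewrite !WE -kraus_defect //; apply: psd_sum => e; exact: psd_adjoint_mul.
apply: (le_trans (inner_dilated_le heisK _ nkv)); apply: (le_trans le1).
have -> : d%:R^-1 * \sum_m \sum_m' Num.conj (entry J m' m) * entry J m' m =
   d%:R^-1 * \sum_m \sum_m' entry (adjoint J *m J) m' m * entry (1%:M : op R 'I_d) m' m.
  congr (_ * _); apply: eq_bigr => m _; rewrite [RHS](bigD1 m) //= [X in _ = _ + X]big1.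
    rewrite entry1 eqxx mulr1 addr0 entryM.
    by apply: eq_bigr => m' _; rewrite entry_adjoint.
  by move=> m' /negPf mm'; rewrite entry1 mm' mulr0.
rewrite -(expect_summoned _ _ vk) le_eqVlt; apply/orP; left; apply/eqP.
apply: eq_expect => z' z; rewrite heis1; last by case: (second_mapP P k true).
rewrite /on_recipient entry1 -mulrA -natrM mulnb; congr (_ * (nat_of_bool _)%:R).
apply/forallP/andP => [h | [zk /forallP h] i].
  split; first by have := h k; rewrite eq_sym vk.
  by apply/forallP => i; apply/implyP => /andP[iv _]; have := h i; rewrite iv.
apply/implyP => iv; have := h i; rewrite iv /=.
by case: eqP => [-> // | _ /=].
Qed.

(** The inner product is the expectation of J^* (x) J at the called pair, and J^* = - J supplies the
    sign. *)
Lemma inner_output (J : op R 'I_d) (v k : 'I_n) :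
  v != k -> ~~ link E v k -> ~~ link E k v -> adjoint J = - J ->
  inner (P := P) (output_vec J v) (output_vec J k) =
  - (d%:R^-1 * \sum_m \sum_m' entry J m' m * entry J m' m).
Proof.
move=> vk nvk nkv JA; rewrite (inner_dilated heisK) //.
have [W WE] := cp_heis_kraus (proj1 (second_mapP P v true)).
rewrite WE adjoint_kraus -WE expect_summoned // JA -mulrN; congr (_ * _).
rewrite -sumrN; apply: eq_bigr => m _; rewrite -sumrN; apply: eq_bigr => m' _.
by rewrite -mulNr -scaleN1r entryZ mulN1r.
Qed.

(* Nonadjacent vertices have opposite vectors, so the complement of the graph
   is coloured by whether a vertex carries the canonical representative of its
   pair {w, - w}. *)
Lemma opposite_vectors_partition m (w : 'I_n -> 'cV[C]_m) :
  (forall i j : 'I_n, E i j <-> E j i) ->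
  (forall v k, v != k -> ~~ link E v k -> ~~ link E k v -> w v + w k = 0 /\ w v != 0) ->
  two_clique_partition E.
Proof.
move=> Esym opp.
pose Q (u : 'cV[C]_m) := [pred x | (x == u) || (x == - u)].
pose col v := choose (Q (w v)) (w v) == w v.
have Qw v : Q (w v) (w v) by rewrite /= eqxx.
have colE v k : v != k -> ~~ E v k -> col v = ~~ col k.
  move=> vk nE.
  have nvk : ~~ link E v k by rewrite /link negb_or vk.
  have nkv : ~~ link E k v.
    by rewrite /link negb_or eq_sym vk; apply/negP => /Esym; apply/negP.
  have [/eqP] := opp v k vk nvk nkv; rewrite addrC addr_eq0 => /eqP wk w0.
  (* [choose] depends only on the set chosen from, so [v] and [k] select the same representative of
     {w, - w}. *)
  have QE : Q (w k) =1 Q (w v) by move=> x; rewrite /= wk opprK orbC.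
  have chE : choose (Q (w k)) (w k) = choose (Q (w v)) (w v).
    by rewrite (eq_choose QE) (choose_id (y0 := w v)) ?Qw // -QE Qw.
  have wN : (w v == - w v) = false.
    by rewrite -addr_eq0 -mulr2n -scaler_nat scaler_eq0 pnatr_eq0 (negPf w0).
  have := chooseP (Qw v); rewrite /col chE wk /= => /orP[] /eqP ->.
    by rewrite eqxx wN.
  by rewrite eqxx eq_sym wN.
exists [set v | col v], [set v | ~~ col v]; split.
- by apply/setP => v; rewrite !inE orbN.
- by apply/setP => v; rewrite !inE andbN.
- move=> v k; rewrite !inE => cv ck vk; apply/negPn/negP => /(colE v k vk).
  by rewrite cv ck.
- move=> v k; rewrite !inE => cv ck vk; apply/negPn/negP => /(colE v k vk).
  by rewrite (negPf cv) ck.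
Qed.

End Necessity.

Lemma achievable_two_clique (R : realType) (d : nat) (n : nat) (E : rel 'I_n) :
  (2 <= d)%N -> (forall i j : 'I_n, E i j <-> E j i) ->
  summoning_achievable E R d -> two_clique_partition E.
Proof.
move=> hd Esym [P summons].
(* Kraus families for all bits and vertices are picked at once by finite choice over pairs. *)
pose KT (bi : bool * 'I_n) := (sent E (message P) bi.2 * resource P bi.2)%type ->
   'M[R[i]]_(#|{: sent E (message P) bi.2}|, #|{: resource P bi.2}|).
have [K0 K0E] : exists K : forall bi, KT bi,
    forall bi, heis (first_map P bi.2 bi.1) =1 kraus (K bi).
  apply: (@fin_all_exists _ KT (fun bi K => heis (first_map P bi.2 bi.1) =1 kraus K)) => bi.
  exact: cp_heis_kraus (proj1 (first_mapP P bi.2 bi.1)).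
pose K b i := K0 (b, i).
have heisK b i : heis (first_map P i b) =1 kraus (K b i) by apply: (K0E (b, i)).
pose o0 : 'I_d := Ordinal (ltnW hd); pose o1 : 'I_d := Ordinal hd.
pose J : op R 'I_d := mkop (fun x y =>
  ((x == o0) && (y == o1))%:R - ((x == o1) && (y == o0))%:R).
have JA : adjoint J = - J.
  apply: op_eqP => x y; rewrite entry_adjoint -scaleN1r entryZ !entry_mkop.
  by rewrite rmorphB /= !conjC_nat mulN1r opprB [(y == o0) && _]andbC [(y == o1) && _]andbC.
pose s : R[i] := \sum_m \sum_m' Num.conj (entry J m' m) * entry J m' m.
(* [J] is real, so the constant in the inner product equals the one in the norm bound. *)
have JJ m m' : entry J m' m * entry J m' m = Num.conj (entry J m' m) * entry J m' m.
  by rewrite entry_mkop rmorphB /= !conjC_nat.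
have s0 : 0 < s.
  rewrite /s (bigD1 o1) //= (bigD1 o0) //= ltr_wpDr //.
    apply: sumr_ge0 => m _; apply: sumr_ge0 => m' _.
    by rewrite mulrC -normCK exprn_ge0.
  rewrite ltr_wpDr //; first by apply: sumr_ge0 => m _; rewrite mulrC -normCK exprn_ge0.
  by rewrite entry_mkop !eqxx /= subr0 rmorph1 mulr1 ltr01.
pose c := d%:R^-1 * s.
have c0 : 0 < c by rewrite mulr_gt0 // invr_gt0 ltr0n (ltnW hd).
pose D := output_vec K J.
(* Factoring the Gram matrix replaces the [D v] by column vectors with the same inner products,
   where norm zero does imply zero. *)
pose G : op R 'I_n := mkop (fun v k => inner (P := P) (D v) (D k)).
have [B GE] : exists B : op R 'I_n, G = adjoint B *m B.
  apply: psd_gram; apply/psdP => h.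
  have := inner_ge0 (P := P) (fun l x => \sum_j h j * D j l x).
  rewrite inner_suml; congr (0 <= _); apply: eq_bigr => v _.
  rewrite inner_sumr mulr_sumr; apply: eq_bigr => k _.
  by rewrite entry_mkop mulrAC mulrA.
pose w v : 'cV[R[i]]_(#|{: 'I_n}|) := B *m delta_mx (enum_rank v) 0.
have wE v k : (adjoint (w v) *m w k) 0 0 = inner (P := P) (D v) (D k).
  rewrite adjointM -mulmxA [adjoint B *m _]mulmxA -GE /adjoint trmx_delta map_delta_mx.
  by rewrite -rowE -colE !mxE !enum_rankK.
apply: (opposite_vectors_partition (w := w)) => // v k vk nvk nkv.
have vk_c : inner (P := P) (D v) (D k) = - c.
  rewrite (inner_output summons heisK) //; congr (- (_ * _)).
  by do 2![apply: eq_bigr => ? _]; rewrite JJ.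
have kv_c : inner (P := P) (D k) (D v) = - c.
  rewrite (inner_output summons heisK) 1?eq_sym //; congr (- (_ * _)).
  by do 2![apply: eq_bigr => ? _]; rewrite JJ.
split; last first.
  apply: contraTneq c0 => wv0; have := wE v k.
  rewrite wv0 /adjoint trmx0 map_mx0 mul0mx mxE vk_c => /eqP.
  by rewrite eq_sym oppr_eq0 => /eqP ->; rewrite ltxx.
(* The squared norm of [w v + w k] is at most c - c - c + c = 0. *)
apply: adjoint_mul_eq0; apply/eqP; rewrite eq_le adjoint_mul_ge0 andbT.
rewrite adjoint_mulD !wE vk_c kv_c.
have := inner_output_le summons heisK J vk nkv; rewrite -/s -/c -/(D v) -subr_le0 => le_v.
have := inner_output_le summons heisK J _ nvk; rewrite eq_sym => /(_ vk).
rewrite -/s -/c -/(D k) -subr_le0 => le_k.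
by rewrite [- c + _]addrC -[0]addr0 lerD.
Qed.

(** * Channels given by Kraus operators *)

Section KrausMaps.
Variables (R : realType) (T U J : finType) (k : J -> U -> T -> R[i]).
Local Notation C := R[i].

Definition kraus_map (rho : op R T) : op R U :=
  mkop (fun y y' => \sum_j \sum_x \sum_x' entry rho x x' * (k j y x * Num.conj (k j y' x'))).

Fact kraus_map_linear : linear kraus_map.
Proof.
move=> a A B; apply: op_eqP => y y'; rewrite entryD entryZ !entry_mkop mulr_sumr -big_split.
apply: eq_bigr => j _; rewrite mulr_sumr -big_split; apply: eq_bigr => x _.
rewrite mulr_sumr -big_split; apply: eq_bigr => x' _ /=.
by rewrite entryD entryZ mulrDl -mulrA.
Qed.

HB.instance Definition _ := GRing.isLinear.Build C (op R T) (op R U) _ kraus_map kraus_map_linear.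

Lemma choi_kraus_map x x' y y' :
  choi kraus_map x x' y y' = \sum_j k j y x * Num.conj (k j y' x').
Proof.
rewrite /choi entry_mkop; apply: eq_bigr => j _.
rewrite (bigD1 x) //= [X in _ + X]big1 ?addr0; last first.
  by move=> z /negPf zx; rewrite big1 // => z' _; rewrite entry_unit zx !mul0r.
rewrite (bigD1 x') //= big1 ?addr0; first by rewrite entry_unit !eqxx !mul1r.
by move=> z /negPf zx; rewrite entry_unit zx mulr0 mul0r.
Qed.

(** The form of the ampliation at [h] is the sum over [j] of the form of [rho] at [g j], the vector
    [h] pulled back by the adjoint of the [j]-th Kraus operator. The long middle part only permutes
    sums. *)
Lemma kraus_map_cp : completely_positive kraus_map.
Proof.
move=> S rho /psdP rho0; apply/psdP => h.
pose g j (q : T * S) := \sum_u Num.conj (k j u q.1) * h (u, q.2).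
have -> : \sum_p \sum_q Num.conj (h p) * entry (ampliation kraus_map rho) p q * h q =
    \sum_j \sum_p \sum_q Num.conj (g j p) * entry rho p q * g j q.
  pose F j (s s' : S) (u u' : U) (x x' : T) := Num.conj (h (u, s)) * k j u x *
     entry rho (x, s) (x', s') * (Num.conj (k j u' x') * h (u', s')).
  transitivity (\sum_u \sum_s \sum_u' \sum_s' \sum_j \sum_x \sum_x' F j s s' u u' x x').
    rewrite [RHS]pair_bigA; apply: eq_bigr => -[u s] _ /=.
    rewrite [RHS]pair_bigA; apply: eq_bigr => -[u' s'] _ /=.
    rewrite !entry_mkop mulr_sumr mulr_suml; apply: eq_bigr => j _.
    rewrite mulr_sumr mulr_suml; apply: eq_bigr => x _.
    rewrite mulr_sumr mulr_suml; apply: eq_bigr => x' _.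
    rewrite entry_mkop /F /= -!mulrA; congr (_ * _).
    by rewrite mulrCA; congr (_ * _); rewrite !mulrA.
  transitivity (\sum_j \sum_x \sum_s \sum_x' \sum_s' \sum_u \sum_u' F j s s' u u' x x').
    under eq_bigr => u _ do under eq_bigr => s _ do under eq_bigr => u' _ do rewrite exchange_big /=.
    under eq_bigr => u _ do under eq_bigr => s _ do rewrite exchange_big /=.
    under eq_bigr => u _ do rewrite exchange_big /=.
    rewrite exchange_big /=; apply: eq_bigr => j _.
    transitivity (\sum_u \sum_s \sum_u' \sum_x \sum_s' \sum_x' F j s s' u u' x x').
      by do 3![apply: eq_bigr => ? _]; rewrite exchange_big.
    transitivity (\sum_u \sum_s \sum_x \sum_u' \sum_s' \sum_x' F j s s' u u' x x').
      by do 2![apply: eq_bigr => ? _]; rewrite exchange_big.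
    transitivity (\sum_u \sum_x \sum_s \sum_u' \sum_s' \sum_x' F j s s' u u' x x').
      by do 1![apply: eq_bigr => ? _]; rewrite exchange_big.
    rewrite exchange_big; apply: eq_bigr => x _ /=.
    rewrite exchange_big; apply: eq_bigr => s _ /=.
    transitivity (\sum_u \sum_u' \sum_x' \sum_s' F j s s' u u' x x').
      by do 2![apply: eq_bigr => ? _]; rewrite exchange_big.
    transitivity (\sum_u \sum_x' \sum_u' \sum_s' F j s s' u u' x x').
      by do 1![apply: eq_bigr => ? _]; rewrite exchange_big.
    rewrite exchange_big; apply: eq_bigr => x' _ /=.
    transitivity (\sum_u \sum_s' \sum_u' F j s s' u u' x x').
      by do 1![apply: eq_bigr => ? _]; rewrite exchange_big.
    by rewrite exchange_big.
  apply: eq_bigr => j _; rewrite pair_bigA; apply: eq_bigr => -[x s] _ /=.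
  rewrite pair_bigA; apply: eq_bigr => -[x' s'] _ /=.
  rewrite /g rmorph_sum /= !mulr_suml; apply: eq_bigr => u _.
  rewrite mulr_sumr; apply: eq_bigr => u' _.
  by rewrite /F rmorphM /= conjCK [k _ _ _ * _]mulrC.
by apply: sumr_ge0 => j _; apply: rho0.
Qed.

Lemma kraus_map_tp :
  (forall x x', \sum_j \sum_y k j y x * Num.conj (k j y x') = (x == x')%:R) ->
  trace_preserving kraus_map.
Proof.
move=> k1 rho; rewrite !mxtrace_entry.
transitivity (\sum_x \sum_x' entry rho x x' * (x == x')%:R).
  transitivity (\sum_y \sum_j \sum_x \sum_x' entry rho x x' * (k j y x * Num.conj (k j y x'))).
    by apply: eq_bigr => y _; rewrite entry_mkop.
  rewrite exchange_big /=; under eq_bigr => j _ do rewrite exchange_big /=.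
  rewrite exchange_big; apply: eq_bigr => x _ /=.
  under eq_bigr => j _ do rewrite exchange_big /=.
  rewrite exchange_big; apply: eq_bigr => x' _ /=; rewrite -k1 mulr_sumr.
  by apply: eq_bigr => j _; rewrite mulr_sumr.
apply: eq_bigr => x _; rewrite (bigD1 x) //= big1 ?addr0; first by rewrite eqxx mulr1.
by move=> x' /negPf; rewrite eq_sym => ->; rewrite mulr0.
Qed.

End KrausMaps.

(** * Protocols whose maps send basis labels to basis labels up to weights *)

Section MonomialProtocol.
Variables (n : nat) (E : rel 'I_n) (R : realType) (d : nat) (P : protocol E R d).
Local Notation C := R[i].
Local Notation X := (resource P).
Local Notation Y := (message P).
Local Notation rec := (tensor (received E Y)).
Variables (Lam S : finType) (c0 : C) (Xs : Lam -> tensor X).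
Variable A : forall i, bool -> S -> X i -> X i -> C.
Variable mu : forall i, bool -> S -> X i -> sent E Y i.
Variable B : forall i, bool -> received E Y i -> received E Y i -> C.
Variable out : forall i, bool -> received E Y i -> 'I_d.
Hypothesis stateE : forall x x', entry (shared_state P) x x' =
  c0 * \sum_l \sum_l' (x == Xs l)%:R * (x' == Xs l')%:R.
Hypothesis firstE : forall i b x x' y y', choi (first_map P i b) x x' y y' =
  \sum_s A b s x x' * ((y == mu b s x)%:R * (y' == mu b s x')%:R).
Hypothesis secondE : forall i b z z' o o', choi (second_map P i b) z z' o o' =
  B b z z' * ((o == out (i := i) b z)%:R * (o' == out b z')%:R).

Definition mono_received (b : 'I_n -> bool) (s : {ffun 'I_n -> S}) (l : Lam) : rec :=
  by_recipient (P := P) (finfun (fun i => mu (b i) (s i) (Xs l i))).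

Lemma prod_by_sender (y : tensor (sent E Y)) (z : rec) :
  \prod_i ((by_sender z i == y i)%:R : C) = (z == by_recipient (P := P) y)%:R.
Proof.
rewrite prod_nat_bool; congr (nat_of_bool _)%:R; apply/forallP/eqP => [h | -> i].
  rewrite -[LHS](@by_senderK n E R d P); congr by_recipient; apply/ffunP => i.
  exact/eqP/h.
by have /(congr1 (fun y0 : tensor (sent E Y) => y0 i)) -> := @by_recipientK n E R d P y; apply: eqxx.
Qed.

(** [l] and [l'] are the branches of the shared state on the ket and the bra side; the Kraus indices
    [s] are common to both sides. *)
Lemma expect_mono b w : expect (P := P) b w =
  c0 * \sum_l \sum_l' \sum_(s : {ffun 'I_n -> S}) (\prod_i A (b i) (s i) (Xs l i) (Xs l' i)) *
    w (mono_received b s l') (mono_received b s l).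
Proof.
have trE z z' : entry (transmitted P b) z z' =
    c0 * \sum_l \sum_l' \sum_(s : {ffun 'I_n -> S}) (\prod_i A (b i) (s i) (Xs l i) (Xs l' i)) *
    ((z == mono_received b s l)%:R * (z' == mono_received b s l')%:R).
  rewrite entry_mkop entry_mkop.
  pose F (x x' : tensor X) := \prod_i choi (first_map P i (b i)) (x i) (x' i) (by_sender z i) (by_sender z' i).
  transitivity (\sum_x \sum_x' c0 * \sum_l \sum_l' (x == Xs l)%:R * (x' == Xs l')%:R * F x x').
    apply: eq_bigr => x _; apply: eq_bigr => x' _; rewrite stateE -mulrA; congr (_ * _).
    rewrite mulr_suml; apply: eq_bigr => l _; rewrite mulr_suml.
    by apply: eq_bigr => l' _.
  transitivity (c0 * \sum_l \sum_l' F (Xs l) (Xs l')).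
    under eq_bigr => x _ do rewrite -mulr_sumr exchange_big /=.
    rewrite -mulr_sumr exchange_big; congr (_ * _); apply: eq_bigr => l _ /=.
    under eq_bigr => x _ do rewrite exchange_big /=.
    rewrite exchange_big; apply: eq_bigr => l' _ /=.
    rewrite (bigD1 (Xs l)) //= [X in _ + X]big1 ?addr0; last first.
      by move=> x /negPf xl; rewrite big1 // => x' _; rewrite xl !mul0r.
    rewrite (bigD1 (Xs l')) //= big1 ?addr0; first by rewrite !eqxx !mul1r.
    by move=> x /negPf xl; rewrite xl mulr0 mul0r.
  congr (_ * _); apply: eq_bigr => l _; apply: eq_bigr => l' _; rewrite /F.
  under eq_bigr => i _ do rewrite firstE.
  rewrite bigA_distr_bigA; apply: eq_bigr => s _; rewrite !big_split /=; congr (_ * _).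
  rewrite /mono_received -!prod_by_sender.
  by congr (_ * _); apply: eq_bigr => i _; rewrite ffunE.
rewrite /expect.
transitivity (\sum_z \sum_z' c0 * \sum_l \sum_l' \sum_(s : {ffun 'I_n -> S})
    (\prod_i A (b i) (s i) (Xs l i) (Xs l' i)) *
    ((z == mono_received b s l)%:R * (z' == mono_received b s l')%:R) * w z' z).
  apply: eq_bigr => z _; apply: eq_bigr => z' _; rewrite trE -mulrA; congr (_ * _).
  rewrite mulr_suml; apply: eq_bigr => l _; rewrite mulr_suml; apply: eq_bigr => l' _.
  by rewrite mulr_suml.
under eq_bigr => x _ do rewrite -mulr_sumr exchange_big /=.
rewrite -mulr_sumr exchange_big; congr (_ * _); apply: eq_bigr => l _ /=.
under eq_bigr => x _ do rewrite exchange_big /=.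
rewrite exchange_big; apply: eq_bigr => l' _ /=.
under eq_bigr => x _ do rewrite exchange_big /=.
rewrite exchange_big; apply: eq_bigr => s _ /=.
rewrite (bigD1 (mono_received b s l)) //= [X in _ + X]big1 ?addr0; last first.
  by move=> x /negPf xl; rewrite big1 // => x' _; rewrite xl mul0r mulr0 mul0r.
rewrite (bigD1 (mono_received b s l')) //= [X in _ + X]big1 ?addr0; first by rewrite !eqxx !mulr1.
by move=> x /negPf xl; rewrite xl !mulr0 mul0r.
Qed.

(** An entry of the marginal is its pairing with a product of two matrix units. *)
Lemma marginal_mono b v k p q : v != k ->
  entry (marginal2 v k (final_state P b)) p q =
  c0 * \sum_l \sum_l' \sum_(s : {ffun 'I_n -> S}) (\prod_i A (b i) (s i) (Xs l i) (Xs l' i)) *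
    (let z := mono_received b s l in let z' := mono_received b s l' in
     (B (b v) (z v) (z' v) * ((p.1 == out (b v) (z v))%:R * (q.1 == out (b v) (z' v))%:R)) *
     (B (b k) (z k) (z' k) * ((p.2 == out (b k) (z k))%:R * (q.2 == out (b k) (z' k))%:R)) *
     [forall i, (i != v) && (i != k) ==> (z' i == z i)]%:R).
Proof.
move=> vk.
have heisE i z z' o o' : entry (heis (second_map P i (b i)) (basis_unit R o' o)) z' z =
    B (b i) z z' * ((o == out (b i) z)%:R * (o' == out (b i) z')%:R).
  rewrite entry_mkop (bigD1 o) //= [X in _ + X]big1 ?addr0; last first.
    by move=> x /negPf xo; rewrite big1 // => x' _; rewrite entry_unit xo mulr0 mulr0.
  rewrite (bigD1 o') //= big1 ?addr0; first by rewrite entry_unit !eqxx !mulr1 secondE.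
  by move=> x /negPf xo; rewrite entry_unit xo mul0r mulr0.
have := expect_outcomes P b (basis_unit R q.1 p.1) (basis_unit R q.2 p.2) vk.
rewrite (eq_expect _ (w2 := fun z' z =>
   (B (b v) (z v) (z' v) * ((p.1 == out (b v) (z v))%:R * (q.1 == out (b v) (z' v))%:R)) *
   (B (b k) (z k) (z' k) * ((p.2 == out (b k) (z k))%:R * (q.2 == out (b k) (z' k))%:R)) *
   [forall i, (i != v) && (i != k) ==> (z' i == z i)]%:R)); last first.
  by move=> z' z; rewrite !heisE.
rewrite expect_mono => <-.
rewrite (bigD1 p) //= [X in _ + X]big1 ?addr0; last first.
  move=> [a a']; rewrite -pair_eqE /= negb_and => /orP[] /negPf aa; rewrite big1 // => u _.
    by rewrite !entry_unit /= aa mulr0 mul0r mulr0.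
  by rewrite !entry_unit /= aa !mulr0.
rewrite (bigD1 q) //= big1 ?addr0; first by rewrite !entry_unit !eqxx !mulr1.
move=> [a a']; rewrite -pair_eqE /= negb_and => /orP[] /negPf aa.
  by rewrite !entry_unit /= aa !mul0r mulr0.
by rewrite !entry_unit /= aa mul0r !mulr0.
Qed.

End MonomialProtocol.

(** The identity pulls back to the identity through every channel. This fixes the scalar left open
    by the GHZ computation. *)
Lemma trace_marginal (n : nat) (E : rel 'I_n) (R : realType) (d : nat) (P : protocol E R d)
    b v k : v != k -> \sum_p entry (marginal2 v k (final_state P b)) p p = 1.
Proof.
move=> vk; have := expect_outcomes P b 1%:M 1%:M vk.
rewrite (eq_expect _ (w2 := fun z' z => \sum_(p : unit) 1 *
    \prod_i entry (1%:M : op R (sent E (message P) i)) (by_sender z' i) (by_sender z i))); last first.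
  move=> z' z; rewrite big_const card_unit /= addr0 mul1r.
  under eq_bigr => i _ do rewrite entry1.
  rewrite (@prod_by_sender n E R d P (by_sender z) z') (@by_senderK n E R d P z).
  rewrite !heis1 ?entry1; last 2 first.
  - by case: (second_mapP P k (b k)).
  - by case: (second_mapP P v (b v)).
  rewrite -!natrM !mulnb; congr (nat_of_bool _)%:R.
  apply/andP/eqP => [[/andP[/eqP zv /eqP zk] /forallP h] | ->]; last first.
    by rewrite !eqxx; split=> //; apply/forallP => i; rewrite eqxx implybT.
  apply/ffunP => i; have := h i.
  by case: (eqVneq i v) => [-> | _] //; case: (eqVneq i k) => [-> | _] //= /eqP.
rewrite expect_prod big_const card_unit /= addr0 mul1r.
rewrite (eq_state_form (h := fun i => 1%:M)); last first.
  by move=> i; rewrite heis1 //; case: (first_mapP P i (b i)).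
have [_ tr1] := shared_stateP P.
have -> : state_form (P := P) (fun i => 1%:M) = 1.
  rewrite -[RHS]tr1 mxtrace_entry; apply: eq_bigr => x _.
  rewrite (bigD1 x) //= [X in _ + X]big1 ?addr0.
    by rewrite big1 ?mulr1 // => i _; rewrite entry1 eqxx.
  move=> x' xx'; have [i xi] : exists i, x' i != x i.
    by apply/existsP; apply: contraNT xx' => /existsPn h; apply/eqP/ffunP => i; apply/eqP/negPn.
  by rewrite (bigD1 i) //= entry1 (negPf xi) mul0r mulr0.
move=> <-; apply: eq_bigr => p _; rewrite (bigD1 p) //= big1 ?addr0.
  by rewrite !entry1 !eqxx !mulr1.
move=> [a a']; rewrite -pair_eqE /= negb_and => /orP[] /negPf aa.
  by rewrite !entry1 aa mul0r mulr0.
by rewrite !entry1 aa !mulr0.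
Qed.

(** * The GHZ protocol *)

Section GHZProtocol.
Variables (n : nat) (E : rel 'I_n) (R : realType) (d : nat) (o0 : 'I_d) (c : 'I_n -> bool).
Hypothesis cliqueE : forall i j, i != j -> c i = c j -> E i j.
Local Notation C := R[i].
Local Notation D := 'I_d.
Local Notation X := (D * D)%type.
Local Notation S := {ffun X -> bool}.
Local Notation Lam := (D * (D * D))%type.

(** A share, a sign function, and a flag telling whether the sender was called. *)
Definition msg : finType := (X * S * bool)%type.
Local Notation snt i := (sent E (fun _ _ => msg) i).
Local Notation rcv i := (received E (fun _ _ => msg) i).

(** [l] consists of a global label and one label for each clique; a vertex holds the global one and
    that of its own clique. *)
Definition ghz_label (l : Lam) : tensor (fun _ : 'I_n => X : finType) :=
  [ffun i => (l.1, if c i then l.2.1 else l.2.2)].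

Definition ghz_ket : ket R (tensor (fun _ : 'I_n => X : finType)) :=
  mkket (fun x => \sum_l (x == ghz_label l)%:R).

(** The norm depends on whether a clique is empty, since distinct [l] may then give equal labels;
    hence the division by the trace. *)
Definition ghz_state := (\tr (proj_ket ghz_ket))^-1 *: proj_ket ghz_ket.

Lemma entry_ghz x x' : entry (proj_ket ghz_ket) x x' =
  \sum_l \sum_l' (x == ghz_label l)%:R * (x' == ghz_label l')%:R.
Proof.
rewrite /entry /proj_ket mxE big_ord1 !mxE !enum_rankK rmorph_sum mulr_suml.
apply: eq_bigr => l _; rewrite mulr_sumr; apply: eq_bigr => l' _.
by rewrite /= conjC_nat.
Qed.

Lemma ghz_stateP : density ghz_state.
Proof.
have gp : psd (proj_ket ghz_ket).
  by rewrite /proj_ket -{1}(adjointK ghz_ket); apply: psd_adjoint_mul.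
have t0 : 0 < \tr (proj_ket ghz_ket).
  rewrite mxtrace_entry (bigD1 (ghz_label (o0, (o0, o0)))) //=.
  have nn x : 0 <= entry (proj_ket ghz_ket) x x.
    rewrite entry_ghz; apply: sumr_ge0 => l _; apply: sumr_ge0 => l' _.
    by rewrite -natrM ler0n.
  rewrite ltr_wpDr ?sumr_ge0 // entry_ghz (bigD1 (o0, (o0, o0))) //=.
  rewrite ltr_wpDr //.
    by apply: sumr_ge0 => l _; apply: sumr_ge0 => l' _; rewrite -natrM ler0n.
  rewrite (bigD1 (o0, (o0, o0))) //= ltr_wpDr //.
    by apply: sumr_ge0 => l _; rewrite -natrM ler0n.
  by rewrite eqxx mulr1 ltr01.
split.
  move=> v; rewrite -scalemxAr -scalemxAl mxE mulr_ge0 //.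
  by rewrite invr_ge0 ltW.
by rewrite /ghz_state mxtraceZ mulVf // gt_eqF.
Qed.

Definition sgn (s : S) (x : X) : C := (-1) ^+ s x.

Lemma sgnM s x : sgn s x * sgn s x = 1.
Proof. by rewrite /sgn -signr_addb addbb. Qed.

(** For distinct labels, flipping the sign at [x] is an involution on sign functions that negates
    every term. *)
Lemma sum_sgn (x x' : X) : \sum_s sgn s x * sgn s x' = #|{: S}|%:R * (x == x')%:R.
Proof.
case: eqVneq => [<- | xx'].
  by rewrite (eq_bigr (fun=> 1)) ?sumr_const ?mulr1 // => s _; rewrite sgnM.
pose flip (s : S) : S := [ffun y => s y (+) (y == x)].
have flipK : involutive flip.
  by move=> s; apply/ffunP => y; rewrite !ffunE -addbA addbb addbF.
rewrite mulr0; set T := \sum_s _; suff : T = - T.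
  by move/eqP; rewrite -addr_eq0 -mulr2n mulrn_eq0 /= => /eqP.
rewrite {1}/T (reindex flip) /=; last by exists flip => ? _; rewrite flipK.
rewrite -sumrN; apply: eq_bigr => s _; rewrite /sgn !ffunE eqxx eq_sym (negPf xx').
by rewrite addbF addbT signrN mulNr.
Qed.

Let x0 : X := (o0, o0).
Let s0 : S := [ffun=> false].

(** A called vertex keeps its share and announces only its flag; an uncalled one broadcasts its sign
    outcome and retains no share. *)
Definition outgoing (i : 'I_n) (b : bool) (s : S) (x : X) : snt i :=
  [ffun j : {j | link E i j} => if b then ((if val j == i then x else x0), s0, true)
                                else (x0, s, false)].

(** If uncalled, [s] is the random-sign outcome. If called, the same isometry is repeated for every
    [s], each with weight 1/|S|. *)
Definition first_amp (b : bool) (s : S) (x : X) : C :=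
  (sqrtC #|{: S}|%:R)^-1 * (if b then 1 else sgn s x).

Definition first_kraus (i : 'I_n) (b : bool) (s : S) (y : snt i) (x : X) : C :=
  first_amp b s x * (y == outgoing i b s x)%:R.

Definition first_weight (b : bool) (s : S) (x x' : X) : C :=
  #|{: S}|%:R^-1 * ((if b then 1 else sgn s x) * (if b then 1 else sgn s x')).

Lemma first_ampM b s x x' : first_amp b s x * Num.conj (first_amp b s x') = first_weight b s x x'.
Proof.
rewrite /first_amp rmorphM /= mulrACA /first_weight; congr (_ * _).
  by rewrite -normCK normfV exprVn ger0_norm ?sqrtC_ge0 ?ler0n // sqrtCK.
by congr (_ * _); case: b; rewrite ?rmorph1 // /sgn rmorphXn /= rmorphN1.
Qed.

Lemma first_krausM i b s (y y' : snt i) x x' : first_kraus b s y x * Num.conj (first_kraus b s y' x') =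
  first_weight b s x x' * ((y == outgoing i b s x)%:R * (y' == outgoing i b s x')%:R).
Proof. by rewrite /first_kraus rmorphM /= conjC_nat mulrACA first_ampM. Qed.

Lemma sum_bool_pair (T : finType) (a b : T) : \sum_y ((y == a)%:R * (y == b)%:R : C) = (a == b)%:R.
Proof.
rewrite (bigD1 a) //= big1 ?addr0 ?eqxx ?mul1r //.
by move=> y /negPf ->; rewrite mul0r.
Qed.

Lemma card_S_neq0 : #|{: S}|%:R != 0 :> C.
Proof. by rewrite pnatr_eq0 -lt0n; apply/card_gt0P; exists s0. Qed.

Lemma outgoing_self i s x x' : outgoing i true s x = outgoing i true s x' -> x = x'.
Proof.
have lii : link E i i by rewrite /link eqxx.
by move/ffunP/(_ (exist _ i lii)); rewrite !ffunE /= eqxx => -[].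
Qed.

(** A called vertex encodes injectively because it keeps its share; an uncalled one uses the
    orthogonality of signs. *)
Lemma first_tp i b : trace_preserving (kraus_map (@first_kraus i b)).
Proof.
apply: kraus_map_tp => x x'.
transitivity (\sum_s first_weight b s x x' * (outgoing i b s x == outgoing i b s x')%:R).
  apply: eq_bigr => s _; rewrite -sum_bool_pair mulr_sumr.
  by apply: eq_bigr => y _; rewrite first_krausM.
case: b.
  rewrite (eq_bigr (fun=> #|{: S}|%:R^-1 * (x == x')%:R)).
    by rewrite sumr_const -[LHS]mulr_natr mulrAC mulVf ?mul1r // card_S_neq0.
  move=> s _; rewrite /first_weight !mulr1; congr (_ * (nat_of_bool _)%:R).
  by apply/eqP/eqP => [/outgoing_self | ->].
rewrite (eq_bigr (fun s => #|{: S}|%:R^-1 * (sgn s x * sgn s x'))).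
  by rewrite -mulr_sumr sum_sgn mulrA mulVf ?mul1r // card_S_neq0.
by move=> s _; rewrite /outgoing /= eqxx mulr1.
Qed.

(** * Decoding at a vertex *)

Section SecondMap.
Variable v : 'I_n.

(** A missing link reads as an uncalled sender with trivial signs. Only [v] and its clique mates are
    consulted below, and these are linked to [v]. *)
Definition incoming (z : rcv v) (j : 'I_n) : msg :=
  if insub j is Some j' then z j' else (x0, s0, false).

Definition own (z : rcv v) : X := (incoming z v).1.1.

Definition partner (z : rcv v) : bool :=
  [exists j, [&& j != v, c j == c v & (incoming z j).2]].

Definition leads (z : rcv v) : bool :=
  [forall j, (c j == c v) && (incoming z j).2 ==> (v <= j)%N].

(** Only the first called vertex of a clique corrects, so that no sign is corrected twice. *)
Definition parity (b : bool) (z : rcv v) : bool :=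
  [&& b, leads z & \big[addb/false]_(j | (c j == c v) && ~~ (incoming z j).2)
                     (incoming z j).1.2 (own z)].

Definition output (b : bool) (z : rcv v) : D :=
  if b then (if partner z then (own z).2 else (own z).1) else o0.

(* What remains after the output system has been split off. *)
Definition leftover (b : bool) (z : rcv v) : rcv v :=
  if b then
    [ffun j : {j | link E j v} => if val j == v
       then ((if partner z then ((z j).1.1.1, o0) else (o0, (z j).1.1.2)), (z j).1.2, (z j).2)
       else z j]
  else z.

Lemma leftoverE z (j : {j | link E j v}) : leftover true z j =
  if val j == v
  then ((if partner z then ((z j).1.1.1, o0) else (o0, (z j).1.1.2)), (z j).1.2, (z j).2)
  else z j.
Proof. by rewrite /leftover ffunE. Qed.

Lemma incoming_val z (j : {j | link E j v}) : incoming z (val j) = z j.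
Proof. by rewrite /incoming valK. Qed.

Lemma own_val z (j : {j | link E j v}) : val j = v -> own z = (z j).1.1.
Proof. by move=> jv; rewrite /own -(incoming_val z j) jv. Qed.

Lemma incoming_flag_leftover b z j : (incoming (leftover b z) j).2 = (incoming z j).2.
Proof.
rewrite /incoming; case: insubP => // j' _ _; rewrite /leftover; case: b => //.
by rewrite ffunE; case: ifP.
Qed.

Lemma partner_leftover b z : partner (leftover b z) = partner z.
Proof. by apply: eq_existsb => j; rewrite incoming_flag_leftover. Qed.

(** The leftover retains the flags, hence reveals which half of the share was output; the output
    restores that half. *)
Lemma output_leftover_inj b z z' :
  output b z = output b z' -> leftover b z = leftover b z' -> z = z'.
Proof.
move=> oz lz; have pz : partner z = partner z' by rewrite -(partner_leftover b) lz partner_leftover.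
case: b oz lz => //= oz /ffunP lz; apply/ffunP => j; have := lz j; rewrite !ffunE.
case: eqP => // jv; move: oz; rewrite pz !(own_val _ jv).
by case: (z j) => [[[? ?] ?] ?]; case: (z' j) => [[[? ?] ?] ?] /=; case: ifP => _ -> [-> -> ->].
Qed.

(** The isometry sending z to the signed pair of output and leftover, with the leftover traced out
    as Kraus index [e]. *)
Definition second_kraus (b : bool) (e : rcv v) (o : D) (z : rcv v) : C :=
  (-1) ^+ parity b z * (e == leftover b z)%:R * (o == output b z)%:R.

Definition second_weight (b : bool) (z z' : rcv v) : C :=
  (-1) ^+ parity b z * (-1) ^+ parity b z' * (leftover b z == leftover b z')%:R.

Lemma sum_second_kraus b o o' z z' :
  \sum_e second_kraus b e o z * Num.conj (second_kraus b e o' z') =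
  second_weight b z z' * ((o == output b z)%:R * (o' == output b z')%:R).
Proof.
rewrite /second_weight -sum_bool_pair mulr_sumr mulr_suml; apply: eq_bigr => e _.
rewrite /second_kraus !rmorphM /= !conjC_nat rmorphXn /= rmorphN1.
by rewrite mulrACA; congr (_ * _); rewrite mulrACA.
Qed.

Lemma second_tp b : trace_preserving (kraus_map (second_kraus b)).
Proof.
apply: kraus_map_tp => z z'; rewrite exchange_big.
under eq_bigr do rewrite sum_second_kraus.
rewrite -mulr_sumr sum_bool_pair /second_weight.
case: (eqVneq z z') => [<- | zz']; first by rewrite !eqxx -signr_addb addbb !mulr1.
case: eqP => [lz | _]; last by rewrite mulr0 mul0r.
case: eqP => [oz | _]; last by rewrite mulr0.
by case/eqP: zz'; apply: output_leftover_inj oz lz.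
Qed.

End SecondMap.

Definition ghz_protocol : protocol E R d := @Protocol n E R d (fun _ => X) (fun _ _ => msg)
  ghz_state
  (fun i b => kraus_map (@first_kraus i b))
  (fun i b => kraus_map (@second_kraus i b))
  ghz_stateP
  (fun i b => conj (kraus_map_cp _) (first_tp i b))
  (fun i b => conj (kraus_map_cp _) (second_tp (v := i) b)).

Local Notation arrival b s l := (mono_received (P := ghz_protocol) ghz_label outgoing b s l).

Lemma arrivalE b s l i (j : {j | link E j i}) : (arrival b s l i : rcv i) j =
  if b (val j) then ((if i == val j then ghz_label l (val j) else x0), s0, true)
  else (x0, s (val j), false).
Proof. by rewrite /mono_received !ffunE. Qed.

(** * What a called vertex receives and computes *)

Section Called.
Variables (u w : 'I_n) (b : 'I_n -> bool) (s : {ffun 'I_n -> S}).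
Hypotheses (uw : u != w) (bE : b =1 calls u w).
Let bu : b u. Proof. by rewrite bE /calls eqxx. Qed.

Lemma incoming_arrival l j : c j = c u -> incoming (arrival b s l u : rcv u) j =
  if b j then ((if u == j then ghz_label l j else x0), s0, true) else (x0, s j, false).
Proof.
move=> cj; have ju : link E j u.
  by rewrite /link; case: eqVneq => //= ju; apply: cliqueE.
by rewrite /incoming insubT arrivalE.
Qed.

Lemma own_arrival l : own (arrival b s l u : rcv u) = ghz_label l u.
Proof. by rewrite /own incoming_arrival // bu eqxx. Qed.

Lemma partner_arrival l : partner (arrival b s l u : rcv u) = (c w == c u).
Proof.
apply/existsP/eqP => [[j /and3P[ju /eqP cj]] | cw].
  rewrite incoming_arrival // bE /calls (negPf ju) /=.
  by case: eqP => // <-.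
exists w; rewrite eq_sym uw cw eqxx incoming_arrival //.
by rewrite bE /calls eqxx orbT.
Qed.

Lemma leads_arrival l : leads (arrival b s l u : rcv u) = ((c w == c u) ==> (u <= w)%N).
Proof.
apply/forallP/implyP => [h cw | h j].
  have := h w; rewrite cw incoming_arrival ?(eqP cw) //.
  by rewrite bE /calls eqxx orbT.
case: eqP => //= cj; rewrite incoming_arrival // bE /calls.
by case: eqVneq => [-> | _] /=; rewrite ?leqnn //; case: eqP cj => [-> cw | //]; rewrite h // cw.
Qed.

Lemma output_arrival l : output true (arrival b s l u : rcv u) =
  if c w == c u then (ghz_label l u).2 else (ghz_label l u).1.
Proof. by rewrite /output partner_arrival own_arrival. Qed.

(** Flags and signs do not depend on the branch, so the leftovers can differ only in the half share
    that was not output. *)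
Lemma leftover_arrival l l' :
  (leftover true (arrival b s l u : rcv u) == leftover true (arrival b s l' u : rcv u)) =
  if c w == c u then (ghz_label l u).1 == (ghz_label l' u).1
  else (ghz_label l u).2 == (ghz_label l' u).2.
Proof.
have luu : link E u u by rewrite /link eqxx.
apply/eqP/idP => [/ffunP/(_ (exist _ u luu)) | h].
  rewrite !leftoverE /= eqxx !partner_arrival !arrivalE /= bu eqxx /=.
  by case: ifP => _ [->]; rewrite eqxx.
apply/ffunP => j; rewrite !leftoverE !partner_arrival !arrivalE.
case: (eqVneq (val j) u) => [-> | ju]; last by [].
by rewrite bu /=; move: h; case: ifP => _ /eqP ->.
Qed.

Lemma sign_arrival l : (-1) ^+ parity true (arrival b s l u : rcv u) =
  (if (c w == c u) ==> (u <= w)%N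
   then \prod_(j | (c j == c u) && ~~ b j) sgn (s j) (ghz_label l u) else 1) :> C.
Proof.
rewrite /parity /= leads_arrival own_arrival; case: ifP => //= _.
rewrite (big_morph (fun b0 : bool => (-1) ^+ b0 : C) (id1 := 1) (op1 := *%R)) //; last first.
  exact: signr_addb.
apply: eq_big => [j | j /andP[/eqP cj bj]].
  by case: eqP => //= cj; rewrite incoming_arrival //; case: (b j).
by rewrite incoming_arrival // in bj *; case: (b j) bj.
Qed.

End Called.

(** Shares are sent only by called vertices, and only to themselves. *)
Lemma arrival_uncalled (b : 'I_n -> bool) (s : {ffun 'I_n -> S}) l l' i : ~~ b i -> arrival b s l i = arrival b s l' i.
Proof.
move=> bi; apply/ffunP => j; rewrite !arrivalE.
case: (eqVneq i (val j)) => // <-; by rewrite (negPf bi).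
Qed.

Lemma ghz_label_eq l i j : c i = c j -> ghz_label l i = ghz_label l j.
Proof. by rewrite !ffunE => ->. Qed.

(* The corrections cancel the random signs of every clique containing a called
   vertex. *)
Lemma total_sign v k (b : 'I_n -> bool) (s : {ffun 'I_n -> S}) l : v != k -> b =1 calls v k ->
  \prod_i (if b i then 1 else sgn (s i) (ghz_label l i)) *
    ((-1) ^+ parity true (arrival b s l v : rcv v) * (-1) ^+ parity true (arrival b s l k : rcv k))
  = \prod_(i | [&& ~~ b i, c i != c v & c i != c k]) sgn (s i) (ghz_label l i).
Proof.
move=> vk bE; have bE' : b =1 calls k v by move=> i; rewrite bE /calls orbC.
have kv : k != v by rewrite eq_sym.
rewrite (sign_arrival s bE) (sign_arrival s bE').
pose Q u := \prod_(i | (c i == c u) && ~~ b i) sgn (s i) (ghz_label l i).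
have QE u : \prod_(i | (c i == c u) && ~~ b i) sgn (s i) (ghz_label l u) = Q u.
  by apply: eq_bigr => i /andP[/eqP ci _]; rewrite (ghz_label_eq l ci).
have QQ u : Q u * Q u = 1 by rewrite -big_split big1 // => i _ /=; rewrite sgnM.
rewrite !QE.
have -> : \prod_i (if b i then 1 else sgn (s i) (ghz_label l i)) =
    Q v * \prod_(i | (c i != c v) && ~~ b i) sgn (s i) (ghz_label l i).
  rewrite (bigID (fun i => c i == c v)) /=; congr (_ * _).
    by rewrite /Q big_mkcondr; apply: eq_bigr => i _; case: (b i).
  by rewrite [RHS]big_mkcondr; apply: eq_bigr => i _; case: (b i).
case: (eqVneq (c k) (c v)) => [ckv | ckv] /=.
  (* Both calls in one clique: only the vertex of smaller index corrects. *)
  have QkE : Q k = Q v by rewrite /Q ckv.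
  have -> : (if (v <= k)%N then Q v else 1) * (if (k <= v)%N then Q k else 1) = Q v.
    rewrite QkE; case: (ltngtP v k) => [||/val_inj vkE]; rewrite ?mulr1 ?mul1r //.
    by rewrite vkE eqxx in vk.
  rewrite mulrAC QQ mul1r; apply: eq_bigl => i; rewrite ckv.
  by case: (b i); case: (c i == c v).
(* With calls in both cliques, every vertex shares a clique with [v] or [k], so no sign is left
   over. *)
rewrite [RHS]big_pred0; last first.
  by move=> i; case: (b i); move: ckv; case: (c i); case: (c v); case: (c k).
have -> : \prod_(i | (c i != c v) && ~~ b i) sgn (s i) (ghz_label l i) = Q k.
  by apply: eq_bigl => i; congr (_ && _); move: ckv; case: (c i); case: (c v); case: (c k).
by rewrite mulrACA QQ QQ mulr1.
Qed.

(** Both called vertices output the label [l.1], which forces equal outputs; the other labels sum to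
    a constant independent of [p] and [q]. *)
Lemma sum_labels (p q : D * D) (F : D * D -> D * D -> C) :
  \sum_(l : Lam) \sum_(l' : Lam) (((p.1 == l.1)%:R * (q.1 == l'.1)%:R) *
     ((p.2 == l.1)%:R * (q.2 == l'.1)%:R) * F l.2 l'.2)
  = (\sum_h \sum_h' F h h') * ((p.1 == p.2)%:R * (q.1 == q.2)%:R).
Proof.
rewrite -(pair_bigA _ (fun a h => \sum_(l' : Lam) (((p.1 == a)%:R * (q.1 == l'.1)%:R) *
     ((p.2 == a)%:R * (q.2 == l'.1)%:R) * F h l'.2))) /=.
rewrite (bigD1 p.1) //= [X in _ + X]big1 ?addr0; last first.
  move=> a; rewrite eq_sym => /negPf pa; rewrite big1 // => h _; rewrite big1 // => l' _.
  by rewrite pa !mul0r.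
rewrite mulr_suml; apply: eq_bigr => h _.
rewrite -(pair_bigA _ (fun a h' => (((p.1 == p.1)%:R * (q.1 == a)%:R) *
     ((p.2 == p.1)%:R * (q.2 == a)%:R) * F h h'))) /=.
rewrite (bigD1 q.1) //= [X in _ + X]big1 ?addr0; last first.
  move=> a; rewrite eq_sym => /negPf pa; rewrite big1 // => h' _.
  by rewrite pa mulr0 !mul0r.
rewrite mulr_suml; apply: eq_bigr => h' _.
by rewrite !eqxx !mul1r mulrC [p.2 == _]eq_sym [q.2 == _]eq_sym.
Qed.

Let weight : C := \prod_(i < n) #|{: S}|%:R^-1.

Lemma ghz_marginal_sum v k p q : v != k ->
  entry (marginal2 v k (final_state ghz_protocol (calls v k))) p q =
  (\tr (proj_ket ghz_ket))^-1 * \sum_l \sum_l' \sum_(s : {ffun 'I_n -> S})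
   weight * (\prod_(i | [&& ~~ calls v k i, c i != c v & c i != c k]) sgn (s i) (ghz_label l i) *
    \prod_(i | [&& ~~ calls v k i, c i != c v & c i != c k]) sgn (s i) (ghz_label l' i)) *
   (let o u (x : X) := if c v == c k then x.2 else x.1 in
    let r u (x : X) := if c v == c k then x.1 else x.2 in
    (((p.1 == o v (ghz_label l v))%:R * (q.1 == o v (ghz_label l' v))%:R) *
    ((p.2 == o k (ghz_label l k))%:R * (q.2 == o k (ghz_label l' k))%:R)) *
    ((r v (ghz_label l v) == r v (ghz_label l' v))%:R *
     (r k (ghz_label l k) == r k (ghz_label l' k))%:R)).
Proof.
move=> vk; have kv : k != v by rewrite eq_sym.
have bE' : calls v k =1 calls k v by move=> i; rewrite /calls orbC.
rewrite (marginal_mono (P := ghz_protocol) (c0 := (\tr (proj_ket ghz_ket))^-1) (Xs := ghz_label)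
  (A := fun i => first_weight) (mu := outgoing) (B := second_weight) (out := output)) //; first last.
- by move=> i b z z' o o'; rewrite choi_kraus_map sum_second_kraus.
- move=> i b x x' y y'; rewrite choi_kraus_map; apply: eq_bigr => s _.
  by rewrite first_krausM.
- by move=> x x'; rewrite entryZ entry_ghz.
congr (_ * _); apply: eq_bigr => l _; apply: eq_bigr => l' _; apply: eq_bigr => s _.
rewrite -!(total_sign _ _ vk (fun=> erefl)) /=.
have -> : [forall i, (i != v) && (i != k) ==>
    (arrival (calls v k) s l' i == arrival (calls v k) s l i)].
  apply/forallP => i; apply/implyP => /andP[/negPf iv /negPf ik]; apply/eqP.
  by apply: arrival_uncalled; rewrite /calls iv ik.
have -> : calls v k v by rewrite /calls eqxx.
have -> : calls v k k by rewrite /calls eqxx orbT.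
rewrite /second_weight.
rewrite !(leftover_arrival s vk (fun=> erefl)) !(output_arrival s vk (fun=> erefl)).
rewrite !(leftover_arrival s kv bE') !(output_arrival s kv bE').
rewrite /first_weight !big_split /= -/weight [c k == c v]eq_sym.
set sv := (-1) ^+ _; set sv' := (-1) ^+ _; set sk := (-1) ^+ _; set sk' := (-1) ^+ _.
set G := \prod_i _; set G' := \prod_i _.
case: ifP => _; ring.
Qed.

(** Stated up to a scalar; unit trace determines it afterwards. *)
Lemma ghz_marginal v k : v != k -> exists kappa : C, forall p q,
  entry (marginal2 v k (final_state ghz_protocol (calls v k))) p q =
  kappa * ((p.1 == p.2)%:R * (q.1 == q.2)%:R).
Proof.
move=> vk; pose sel (t : bool) (h : D * D) := if t then h.1 else h.2.
pose idle i := [&& ~~ calls v k i, c i != c v & c i != c k].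
case: (eqVneq (c v) (c k)) => [cvk | cvk].
  pose g (s : {ffun 'I_n -> S}) h := \prod_(i | idle i) sgn (s i) h.
  pose F (h h' : D * D) := \sum_(s : {ffun 'I_n -> S})
    weight * (g s h * g s h') * ((h.1 == h'.1)%:R * (h.1 == h'.1)%:R).
  exists ((\tr (proj_ket ghz_ket))^-1 * \sum_h \sum_h' F h h') => p q.
  rewrite ghz_marginal_sum // -mulrA; congr (_ * _); rewrite cvk eqxx -sum_labels.
  (* Within one clique the clique label is output, so it is exchanged with the global label to bring
     it to the first coordinate, as [sum_labels] expects. *)
  pose swap (m : Lam) : Lam := (m.2.1, if c k then (m.1, m.2.2) else (m.2.2, m.1)).
  pose unswap (l : Lam) : Lam := if c k then (l.2.1, (l.1, l.2.2)) else (l.2.2, (l.1, l.2.1)).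
  have swap_bij : bijective swap.
    exists unswap; rewrite /swap /unswap; first by move=> [a [t f]] /=; case: (c k).
    by move=> [a [t f]] /=; case: (c k).
  rewrite (reindex swap) /=; last exact/onW_bij.
  apply: eq_bigr => l _; rewrite (reindex swap) /=; last exact/onW_bij.
  apply: eq_bigr => l' _; rewrite /F mulr_sumr; apply: eq_bigr => s _.
  have gE m : \prod_(i | [&& ~~ calls v k i, c i != c k & c i != c k]) sgn (s i) (ghz_label (swap m) i) = g s m.2.
    rewrite /g /idle cvk; apply: eq_bigr => i /and3P[_ cik _].
    rewrite !ffunE /swap /=; congr (sgn _ _); case: m => a [t f] /=.
    by move: cik; case: (c i); case: (c k).
  have labE i m : c i = c k -> ghz_label (swap m) i = (m.2.1, m.1).
    by rewrite !ffunE /swap => -> /=; case: (c k).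
  rewrite !gE !labE //=; ring.
pose F (h h' : D * D) := \sum_(s : {ffun 'I_n -> S})
    weight * ((sel (c v) h == sel (c v) h')%:R * (sel (c k) h == sel (c k) h')%:R).
exists ((\tr (proj_ket ghz_ket))^-1 * \sum_h \sum_h' F h h') => p q.
rewrite ghz_marginal_sum // -mulrA; congr (_ * _); rewrite (negPf cvk) -sum_labels.
apply: eq_bigr => l _; apply: eq_bigr => l' _; rewrite /F mulr_sumr; apply: eq_bigr => s _.
have idle0 i : [&& ~~ calls v k i, c i != c v & c i != c k] = false.
  by case: (calls v k i); move: cvk; case: (c i); case: (c v); case: (c k).
rewrite !(big_pred0 _ _ _ _ idle0) !ffunE /= -!/(sel _ _); ring.
Qed.

End GHZProtocol.

(** * Sufficiency and the equivalence *)

Lemma two_clique_achievable (R : realType) (d : nat) (n : nat) (E : rel 'I_n) :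
  (2 <= d)%N -> two_clique_partition E -> summoning_achievable E R d.
Proof.
move=> hd [K1 [K2 [KU KI K1c K2c]]]; pose o0 : 'I_d := Ordinal (ltnW hd).
have cliqueE i j : i != j -> (i \in K1) = (j \in K1) -> E i j.
  move=> ij; have inK u : (u \in K1) || (u \in K2) by rewrite -in_setU KU inE.
  case: (boolP (j \in K1)) => jK iK; first exact: K1c.
  apply: K2c => //; first by have := inK i; rewrite iK.
  by have := inK j; rewrite (negPf jK).
exists (@ghz_protocol n E R d o0 (fun i => i \in K1)) => v k vk.
have [kappa margE] := ghz_marginal R o0 cliqueE vk.
(* Unit trace gives kappa d = 1, the normalization of the maximally entangled state. *)
have := trace_marginal (ghz_protocol E R o0 (fun i => i \in K1)) (calls v k) vk.
under eq_bigr => p _ do rewrite margE.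
rewrite -mulr_sumr.
have -> : \sum_(p : 'I_d * 'I_d) (p.1 == p.2)%:R * (p.1 == p.2)%:R = d%:R :> R[i].
  rewrite -(pair_bigA _ (fun a b : 'I_d => (a == b)%:R * (a == b)%:R)) /=.
  rewrite (eq_bigr (fun=> 1)) ?sumr_const ?card_ord // => a _.
  rewrite (bigD1 a) //= big1 ?addr0 ?eqxx ?mulr1 // => a'.
  by rewrite eq_sym => /negPf ->; rewrite mul0r.
move=> kd; have d0 : d%:R != 0 :> R[i] by rewrite pnatr_eq0 -lt0n ltnW.
apply: op_eqP => p q; rewrite margE entry_max_entangled; congr (_ * _).
by apply: (mulIf d0); rewrite kd mulVf.
Qed.

Theorem theorem1 (R : realType) (d : nat) (hd : (2 <= d)%N)
    (n : nat) (E : rel 'I_n)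
    (E_noloop : forall i : 'I_n, ~~ E i i)
    (E_bidirected : forall i j : 'I_n, E i j <-> E j i) :
  summoning_achievable E R d <-> two_clique_partition E.
Proof.
split; first exact: achievable_two_clique.
exact: two_clique_achievable.
Qed.
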